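(* Assume that, as $N\to\infty$, $M\to\infty$, one has $n\to\infty$, $m\to\infty$, $p=n/N\to0$, $q=m/M\to0$, and $$\frac{\log\log(p^{-1})}{\log(q^{-1})}\to0,\qquad \frac{\log\log(q^{-1})}{\log(p^{-1})}\to0 .$$ Moreover, assume that $n\log(p^{-1})\asymp m\log(q^{-1})$ and that the following two conditions are satisfied: $$a^2nmpq\to0\qquad\text{and}\qquad \limsup\frac{a^2nm}{2\left(n\log(p^{-1})+m\log(q^{-1})\right)}<1 .$$ Then distinguishability is impossible, that is, $\gamma_{nm,a}\to1$ and $\beta_{nm,a,\alpha}\to1-\alpha$ for any $\alpha\in(0,1)$.
   Context: Model: one observes an $N\times M$ matrix $\mathbf Y=\{Y_{ij}\}$, $Y_{ij}=s_{ij}+\xi_{ij}$, with $\xi_{ij}$ i.i.d. standard Gaussian and $s_{ij}\in\mathbb R$. $P_S$, $E_S$ denote probability and expectation when the mean matrix is $S=\{s_{ij}\}$; $P_0,E_0$ correspond to $S=0$ (null hypothesis). The integers $n=n_{NM}\in\{1,\dots,N\}$, $m=m_{NM}\in\{1,\dots,M\}$ and the number $a=a_{NM}>0$ may depend on $N,M$; all limits are as $N\to\infty$, $M\to\infty$. Put $p=n/N$, $q=m/M$. For positive $u,v$ depending on $N,M$, $u\asymp v$ means $0<c\le\liminf u/v$ and $\limsup u/v\le C<\infty$ for some constants $c,C$. $\mathcal C_{nm}$ is the collection of all sets $C=A\times B$ with $A\subset\{1,\dots,N\}$, $\#A=n$, $B\subset\{1,\dots,M\}$, $\#B=m$. $\mathcal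 S_{nm,a}$ is the set of matrices $S$ for which there is $C\in\mathcal C_{nm}$ with $s_{ij}=0$ for $(i,j)\notin C$ and $s_{ij}\ge a$ for $(i,j)\in C$. A test is a measurable function $\psi=\psi(\mathbf Y)\in[0,1]$. Put $\alpha(\psi)=E_0\psi$, $\beta_{nm,a}(\psi)=\sup_{S\in\mathcal S_{nm,a}}E_S(1-\psi)$, $\gamma_{nm,a}=\inf_\psi(\alpha(\psi)+\beta_{nm,a}(\psi))$, and $\beta_{nm,a,\alpha}=\inf_{\psi:\alpha(\psi)\le\alpha}\beta_{nm,a}(\psi)$, the infima being over tests. *)

(* Defs.v *)
From HB Require Import structures.
From mathcomp Require Import all_boot all_order all_algebra.
From mathcomp Require Import all_classical all_reals all_analysis.
From mathcomp Require Import measurable_realfun.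
Set Implicit Arguments.
Unset Strict Implicit.
Unset Printing Implicit Defensive.
Import Order.TTheory GRing.Theory Num.Theory numFieldNormedType.Exports.
Local Open Scope classical_set_scope.
Local Open Scope ring_scope.

(* 'M[T]_(N, M) carries the sigma-algebra generated by the entries; over the
   reals this is the Borel sigma-algebra. *)
Definition measure_matrix_display : measure_display -> measure_display.
Proof. exact. Qed.

Section measurable_matrix.
Context {d : measure_display} {T : measurableType d} (N M : nat).

Definition g_sigma_entries : set_system 'M[T]_(N, M) :=
  <<s \bigcup_(ij : 'I_N * 'I_M)
        preimage_set_system setT (fun Y : 'M[T]_(N, M) => Y ij.1 ij.2)
          measurable >>.

Let entries0 : g_sigma_entries set0.
Proof. exact: sigma_algebra0. Qed.

Let entriesC A : g_sigma_entries A -> g_sigma_entries (~` A).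
Proof. exact: sigma_algebraC. Qed.

Let entries_bigcup (F : _^nat) : (forall i, g_sigma_entries (F i)) ->
  g_sigma_entries (\bigcup_i (F i)).
Proof. exact: sigma_algebra_bigcup. Qed.

HB.instance Definition _ := @isMeasurable.Build (measure_matrix_display d)
  'M[T]_(N, M) g_sigma_entries entries0 entriesC entries_bigcup.

Lemma measurable_entry (i : 'I_N) (j : 'I_M) :
  measurable_fun setT (fun Y : 'M[T]_(N, M) => Y i j).
Proof.
move=> _ B mB; apply: sub_sigma_algebra.
by exists (i, j) => //=; exists B.
Qed.

Lemma measurable_fun_entries d' (T' : measurableType d')
    (f : T' -> 'M[T]_(N, M)) :
  (forall i j, measurable_fun setT (fun x => f x i j)) ->
  measurable_fun setT f.
Proof.
move=> mf; apply: (@measurability _ _ _ _ _ _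
  (\bigcup_(ij : 'I_N * 'I_M)
    preimage_set_system setT (fun Y : 'M[T]_(N, M) => Y ij.1 ij.2)
      measurable)) => //.
move=> _ [_ [[i j] _ [B mB <-]] <-]; rewrite !setTI.
by have := mf i j measurableT B mB; rewrite setTI.
Qed.

End measurable_matrix.

Section iid_probability.
Context {d : measure_display} {T : measurableType d} {R : realType}.

Definition tuple_cons n (x : T * n.-tuple T) : n.+1.-tuple T :=
  [the n.+1.-tuple T of x.1 :: x.2].

Let measurable_tuple_cons n : measurable_fun setT (@tuple_cons n).
Proof. exact: measurable_cons. Qed.

HB.instance Definition _ n := isMeasurableFun.Build _ _ _ _ (@tuple_cons n)
  (@measurable_tuple_cons n).

(* law of n independent variables with common law P *)
Fixpoint iid_prob (P : probability T R) (n : nat) :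
    probability (n.-tuple T) R :=
  if n is k.+1
  then distribution (P \x iid_prob P k)%E (@tuple_cons k)
  else \d_[tuple].

End iid_probability.

Section gaussian_matrix.
Context (R : realType) (N M : nat).

(* normal_prob is a measure on measurableTypeR R, an alias of R with the same
   measurable sets; the matrices below have entries in R itself. *)
Definition matrix_of_tuples (x : N.-tuple (M.-tuple (measurableTypeR R))) :
    'M[R]_(N, M) :=
  \matrix_(i, j) tnth (tnth x i) j.

Let measurable_matrix_of_tuples : measurable_fun setT matrix_of_tuples.
Proof.
apply: measurable_fun_entries => i j.
under eq_fun do rewrite mxE.
exact: (measurableT_comp (measurable_tnth j) (measurable_tnth i)).
Qed.

HB.instance Definition _ := isMeasurableFun.Build _ _ _ _ matrix_of_tuples
  measurable_matrix_of_tuples.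

Definition gaussian_noise : probability 'M[R]_(N, M) R :=
  distribution (iid_prob (iid_prob (normal_prob (0 : R) 1) M) N)
    matrix_of_tuples.

Definition signal_plus_noise (S xi : 'M[R]_(N, M)) : 'M[R]_(N, M) := S + xi.

Let measurable_signal_plus_noise S : measurable_fun setT (signal_plus_noise S).
Proof.
apply: measurable_fun_entries => i j.
under eq_fun do rewrite mxE.
by apply: measurable_funD => //; exact: measurable_entry.
Qed.

HB.instance Definition _ S := isMeasurableFun.Build _ _ _ _
  (signal_plus_noise S) (measurable_signal_plus_noise S).

(* P_S, the law of Y = S + xi *)
Definition observation_law (S : 'M[R]_(N, M)) : probability 'M[R]_(N, M) R :=
  distribution gaussian_noise (signal_plus_noise S).

End gaussian_matrix.

Section iid_probability_theory.
Context {d : measure_display} {T : measurableType d} {R : realType}.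
Variable P : probability T R.
Local Open Scope ereal_scope.

Lemma iid_prob_box n (A : 'I_n -> set T) :
  (forall i, measurable (A i)) ->
  iid_prob P n [set x | forall i, A i (tnth x i)] = \prod_(i < n) P (A i).
Proof.
elim: n A => [|n IH] A mA.
  rewrite big_ord0 /= diracE mem_set//= => -[]//.
rewrite big_ord_recl -IH //= /distribution /pushforward.
rewrite -product_measure1E//; last first.
  rewrite [X in measurable X](_ : _ =
    \big[setI/setT]_(i < n) (@tnth n T ^~ i @^-1` (A (lift ord0 i)))).
    apply: bigsetI_measurable => i _; rewrite -[X in measurable X]setTI.
    exact: measurable_tnth.
  by rewrite -bigcap_seq; apply/seteqP; split => x /= Ax i;
    [move=> _; exact: Ax | apply: Ax; rewrite /= mem_index_enum].
congr (product_measure1 _ _ _); apply/seteqP; split => -[t x] /=.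
  move=> Ax; split; first exact: (Ax ord0).
  by move=> i; have := Ax (lift ord0 i); rewrite tnthS.
move=> [At Ax] i; have [j ->|->] := unliftP ord0 i; last exact: At.
by rewrite tnthS; exact: Ax.
Qed.

End iid_probability_theory.

Lemma gaussian_noise_box (R : realType) (N M : nat)
    (A : 'I_N -> 'I_M -> set R) :
  (forall i j, measurable (A i j)) ->
  gaussian_noise R N M [set X : 'M[R]_(N, M) | forall i j, A i j (X i j)] =
  (\prod_(i < N) \prod_(j < M) normal_prob (0 : R) 1 (A i j))%E.
Proof.
move=> mA.
rewrite /gaussian_noise /= /distribution /pushforward.
pose B i := [set y : M.-tuple (measurableTypeR R) |
  forall j, A i j (tnth y j)].
have mB i : measurable (B i).
  rewrite [X in measurable X](_ : _ = \big[setI/setT]_(j < M)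
      ((@tnth M (measurableTypeR R) ^~ j) @^-1` (A i j))).
    apply: bigsetI_measurable => j _; rewrite -[X in measurable X]setTI.
    exact: (measurable_tnth j measurableT (mA i j)).
  by rewrite -bigcap_seq; apply/seteqP; split => x /= Ax j;
    [move=> _; exact: Ax | apply: Ax; rewrite /= mem_index_enum].
transitivity (iid_prob (iid_prob (normal_prob (0 : R) 1) M) N
    [set x | forall i, B i (tnth x i)]).
  by congr (iid_prob _ _ _); apply/seteqP; split => x /= Ax i j;
    have := Ax i j; rewrite mxE.
rewrite (iid_prob_box _ mB); apply: eq_bigr => i _.
exact: (@iid_prob_box _ _ _ (normal_prob (0 : R) 1) M (A i) (mA i)).
Qed.

Section testing.
Context {R : realType} {N M : nat}.
Implicit Types (n m : nat) (a alpha : R) (psi : 'M[R]_(N, M) -> R).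

(* the collection C_{nm} *)
Definition submatrices n m : set {set 'I_N * 'I_M} :=
  [set C | exists (A : {set 'I_N}) (B : {set 'I_M}),
    [/\ #|A| = n, #|B| = m & C = finset.setX A B]].

(* the set S_{nm,a} *)
Definition signals n m a : set 'M[R]_(N, M) :=
  [set S | exists2 C, submatrices n m C &
    (forall i j, (i, j) \notin C -> S i j = 0) /\
    (forall i j, (i, j) \in C -> a <= S i j)].

Definition is_test psi : Prop :=
  measurable_fun setT psi /\ forall Y, 0 <= psi Y <= 1.

(* alpha(psi) *)
Definition type1_error psi : \bar R := ('E_(observation_law 0)[psi])%E.

(* beta_{nm,a}(psi) *)
Definition type2_error n m a psi : \bar R :=
  ereal_sup [set ('E_(observation_law S)[(fun Y => 1 - psi Y)%R])%E |
    S in signals n m a].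

(* gamma_{nm,a} *)
Definition minimax_risk n m a : \bar R :=
  ereal_inf [set (type1_error psi + type2_error n m a psi)%E | psi in is_test].

(* beta_{nm,a,alpha} *)
Definition minimax_type2_error n m a alpha : \bar R :=
  ereal_inf [set type2_error n m a psi | psi in
    [set psi | is_test psi /\ (type1_error psi <= alpha%:E)%E]].

End testing.

Arguments minimax_risk R N M n m a : clear implicits.
Arguments minimax_type2_error R N M n m a alpha : clear implicits.

Definition same_order (R : realType) (u v : nat -> R) : Prop :=
  exists c C : R, [/\ 0 < c,
    (c%:E <= limn_einf (fun k => (u k / v k)%:E))%E &
    (limn_esup (fun k => (u k / v k)%:E) <= C%:E)%E].

(* Main.v *)
(* Bayesian lower bound with a truncated likelihood ratio.  The sum of the two
   errors of a test is at least 1 - E_0 |1 - Z| for every Z below the likelihood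
   ratio of the uniform mixture of the signals a 1_C, C in C_nm, so it suffices
   that E_0 Z and E_0 Z^2 tend to 1.  The plain likelihood ratio has too large a
   second moment; Z damps the term of C as soon as some subrectangle V x W of C
   with #V, #W > 1/a^2 carries a sum above
     a k l + eps (k x + l y) / a,   k = #V, l = #W, x = log(1/p), y = log(1/q).
   Under the signal a 1_C these sums are below the threshold with probability
   tending to 1, because k > 1/a^2 forces k > n / (K y), where log y = o(x), so
   that the entropy of the choice of V is o(k x).  In E_0 Z^2, two rectangles
   with a k x l overlap occur with probability at most C(n,k) p^k C(m,l) q^l;
   after truncation a large overlap costs at most
     a^2 k l / 2 + eps (k x + l y) <= (1 - delta + eps) (k x + l y)
   in the exponent.  Overlaps with k or l at most 1/a^2 are controlled by
   exponential moments and contribute O(a^2 n m p q). *)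
Require Import Defs.
From mathcomp Require Import all_boot all_order all_algebra.
From mathcomp Require Import all_classical all_reals all_analysis.
From mathcomp Require Import measurable_realfun zify ring lra.
Import Order.TTheory GRing.Theory Num.Theory numFieldNormedType.Exports.
Set Implicit Arguments.
Unset Strict Implicit.
Unset Printing Implicit Defensive.
Local Open Scope ring_scope.

(** * Random subsets of fixed cardinality *)

Definition draws N n : {set {set 'I_N}} := [set A : {set 'I_N} | #|A| == n].

Lemma card_drawsE N n : #|draws N n| = 'C(N, n).
Proof. by rewrite /draws card_draws card_ord. Qed.

(** Passing from [k] to [k + 1] multiplies the left binomial by (n - k) / (N - k), which is at most
    n / N. The lower index [N - n] makes the binomial vanish for k > n, whereas a truncated n - k
    would give 1. *)
Lemma bin_shift_le N n k : (n <= N)%N -> (k <= N)%N ->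
  ('C(N - k, N - n) * N ^ k <= n ^ k * 'C(N, n))%N.
Proof.
move=> nN; elim: k => [|k IH] kN; first by rewrite subn0 !muln1 mul1n bin_sub.
have kN' : (k <= N)%N by lia.
have Nk : (0 < N - k)%N by lia.
rewrite -(leq_pmul2l Nk) mulnA subnS mul_bin_down expnS.
have -> : (N - k - (N - n) = n - k)%N by lia.
have h : ((n - k) * N <= n * (N - k))%N by nia.
have := leq_mul h (IH kN').
rewrite expnS; set u := 'C(_, _); set v := (N ^ k)%N; set w := (n ^ k)%N; lia.
Qed.

(** Complementation turns the sets containing [V] into the (N - n)-subsets of the complement of [V].
    In probabilistic terms, a uniform [n]-set contains [V] with probability at most p^#V, where p =
    n / N. *)
Lemma card_draws_sup (R : realType) N n (V : {set 'I_N}) : (0 < n <= N)%N ->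
  (#|[set A in draws N n | V \subset A]|%:R <=
    (n%:R / N%:R) ^+ #|V| * 'C(N, n)%:R :> R).
Proof.
move=> /andP[n0 nN].
have -> : #|[set A in draws N n | V \subset A]| = 'C(N - #|V|, N - n).
  have -> : (N - #|V| = #|~: V|)%N by rewrite [RHS]cardsCs finset.setCK card_ord.
  rewrite -cards_draws -(card_imset _ (@finset.setC_inj _)); congr #|pred_of_set _|.
  apply/finset.setP => B; apply/idP/imsetP => [|[A]].
    rewrite inE => /andP[/[!inE] /eqP Bn VB]; exists (~: B)%SET; last by rewrite finset.setCK.
    by rewrite inE finset.setCS VB cardsCs finset.setCK card_ord Bn eqxx.
  rewrite inE => /andP[AV /eqP An] ->; rewrite !inE cardsCs finset.setCK card_ord.
  by rewrite An subKn// eqxx -finset.setCS finset.setCK.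
have kN : (#|V| <= N)%N by rewrite -[leqRHS]card_ord max_card.
have := bin_shift_le nN kN; rewrite -(ler_nat R) !natrM !natrX => h.
have N0 : 0 < N%:R :> R by rewrite ltr0n; lia.
rewrite expr_div_n mulrAC ler_pdivlMr// exprn_gt0//.
Qed.

Section draws_sum.
Variables (R : realType) (N n : nat).
Hypothesis nN : (0 < n <= N)%N.
Let p : R := n%:R / N%:R.

(** Exchange of sums: a fixed [V] inside [A1] lies in a uniform [A2] with probability at most
    p^#V. *)
Lemma sum_draws_subsets (A1 : {set 'I_N}) (g : {set 'I_N} -> R) :
  (forall V, 0 <= g V) ->
  \sum_(A2 in draws N n) \sum_(V : {set 'I_N} | V \subset A1 :&: A2) g V <=
  'C(N, n)%:R * \sum_(V : {set 'I_N} | V \subset A1) p ^+ #|V| * g V.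
Proof.
move=> g0; rewrite (exchange_big_dep (fun V : {set 'I_N} => V \subset A1))/=; last first.
  by move=> A2 V _; rewrite finset.subsetI => /andP[].
rewrite mulr_sumr; apply: ler_sum => V VA.
rewrite sumr_const mulrA -[leLHS]mulr_natl ler_wpM2r// mulrC.
rewrite (le_trans _ (card_draws_sup R V nN))// ler_nat subset_leq_card//.
by apply/fintype.subsetP => A2; rewrite unfold_in !inE finset.subsetI VA => /andP[-> ->].
Qed.

Lemma sum_draws_capI (A1 : {set 'I_N}) (g : {set 'I_N} -> R) :
  (forall V, 0 <= g V) ->
  \sum_(A2 in draws N n) g (A1 :&: A2) <=
  'C(N, n)%:R * \sum_(V : {set 'I_N} | V \subset A1) p ^+ #|V| * g V.
Proof.
move=> g0; apply: le_trans (sum_draws_subsets A1 g0).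
apply: ler_sum => A2 _; rewrite (bigD1 (A1 :&: A2))//= lerDl.
exact: sumr_ge0.
Qed.

End draws_sum.

Section subset_sums.
Context {R : realType} {T : finType}.
Implicit Types A V : {set T}.

Lemma sum_subsets_expr A (w : R) :
  \sum_(V : {set T} | V \subset A) w ^+ #|V| = (1 + w) ^+ #|A|.
Proof.
(* Expanding the product of the [F i + 1] over all of [T] gives a sum over all subsets; those that
   leave [A] contain a factor 0. *)
pose F i : R := if i \in A then w else 0.
transitivity (\prod_(i : T) (F i + 1)); last first.
  rewrite (bigID (mem A))/= [X in _ * X]big1 ?mulr1 => [|i /negbTE iA].
    rewrite -prodr_const; apply: eq_bigr => i iA.
    by rewrite /F iA addrC.
  by rewrite /F iA add0r.
rewrite (bigA_distr _ _ F (fun=> 1)) big_mkcond/=; apply: eq_bigr => V _.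
rewrite -big_mkcond/=; case: ifPn => [/fintype.subsetP VA|/subsetPn[i iV iA]].
  rewrite -prodr_const; apply: eq_bigr => i iV.
  by rewrite /F VA.
by rewrite (bigD1 i)//= /F (negbTE iA) mul0r.
Qed.

Lemma expr1D_le_expR k (w : R) : 0 <= w -> (1 + w) ^+ k <= expR (k%:R * w).
Proof.
move=> w0; rewrite expRM_natl lerXn2r ?nnegrE ?expR_ge0 ?addr_ge0//.
exact: expR_ge1Dx.
Qed.

(** Chernoff bound: half of the exponent, where #V > K, gives the factor exp(- s K / 2); the other
    half is summed over all subsets of [A]. *)
Lemma sum_large_subsets A (K s : R) : 0 <= s ->
  \sum_(V : {set T} | (V \subset A) && (K < #|V|%:R)) expR (- (s * #|V|%:R)) <=
  expR (#|A|%:R * expR (- (s / 2)) - s * K / 2).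
Proof.
move=> s0; rewrite expRD mulrC.
apply: (@le_trans _ _ (expR (- (s * K / 2)) *
    \sum_(V : {set T} | V \subset A) expR (- (s / 2)) ^+ #|V|)); last first.
  by rewrite ler_pM2l ?expR_gt0// sum_subsets_expr expr1D_le_expR ?expR_ge0.
rewrite mulr_sumr big_mkcondr/=; apply: ler_sum => V _.
case: ifPn => KV; last by rewrite mulr_ge0 ?exprn_ge0 ?expR_ge0.
rewrite -expRM_natl -expRD ler_expR -mulr_natl; nra.
Qed.

End subset_sums.

(** Since exp(t k) is the sum of (exp t - 1)^#V over the subsets [V] of a [k]-set, the exponential
    moment of the hypergeometric overlap is at most that of a binomial variable with parameters #A1
    and n / N. *)
Lemma sum_draws_expR (R : realType) (N n : nat) (A1 : {set 'I_N}) (t : R) :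
  (0 < n <= N)%N -> 0 <= t ->
  \sum_(A2 in draws N n) expR (t * #|A1 :&: A2|%:R) <=
  'C(N, n)%:R * expR (#|A1|%:R * (n%:R / N%:R) * (expR t - 1)).
Proof.
move=> nN t0; have u0 : 0 <= expR t - 1 :> R.
  by rewrite subr_ge0 -[leLHS]expR0 ler_expR.
have := @sum_draws_subsets R N n nN A1 (fun V => (expR t - 1) ^+ #|V|)
  (fun V => exprn_ge0 _ u0).
under eq_bigr => A2 _ do
  rewrite sum_subsets_expr addrC subrK -expRM_natr.
under [X in _ <= _ * X]eq_bigr => V _ do rewrite -exprMn.
rewrite sum_subsets_expr => /le_trans; apply.
by rewrite ler_wpM2l// -mulrA expr1D_le_expR// mulr_ge0// divr_ge0.
Qed.

(** From exp(- t / 2) >= 1 - t / 2 it suffices that (1 - t/2)^2 (1 + 3t) >= 1, and the difference of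
    the two sides is t (1 - t) (2 - 3t/4). *)
Lemma expR_sub1_le (R : realType) (t : R) : 0 <= t -> t <= 1 ->
  expR t - 1 <= 3 * t.
Proof.
move=> t0 t1; have := expR_ge1Dx (- (t / 2)); have := expR_gt0 (- (t / 2)).
have : expR (- (t / 2)) ^+ 2 * expR t = 1.
  by rewrite -expRM_natl -expRD -[RHS]expR0; congr expR; lra.
set e := expR (- _) => h1 e0 h2.
suff : e ^+ 2 * (expR t - 1 - 3 * t) <= 0 by rewrite pmulr_rle0 ?exprn_gt0// subr_le0.
have : (1 - t / 2) ^+ 2 <= e ^+ 2 by rewrite ler_pXn2r ?nnegrE//; lra.
have : 0 <= t * (1 - t) by rewrite mulr_ge0// subr_ge0.
by nra.
Qed.

(** For fixed [B2] the sum over [A2] is an exponential moment with t = b #(B1 :&: B2) <= 1, so that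
    exp t - 1 <= 3 t. The sum over [B2] is then one with parameter 3 n p b per common element, again
    at most 1; the two linearisations produce the factor 9. *)
Lemma sum_draws_expR_mul (R : realType) (N M n m : nat) (A1 : {set 'I_N})
  (B1 : {set 'I_M}) (b : R) :
  (0 < n <= N)%N -> (0 < m <= M)%N -> 0 <= b ->
  #|A1| = n -> #|B1| = m ->
  3 * (n%:R * (n%:R / N%:R) * b) <= 1 ->
  \sum_(A2 in draws N n) \sum_(B2 in draws M m | b * #|B1 :&: B2|%:R <= 1)
    (expR (b * #|A1 :&: A2|%:R * #|B1 :&: B2|%:R) - 1) <=
  'C(N, n)%:R * 'C(M, m)%:R *
  (expR (9 * (b * (n%:R * (n%:R / N%:R)) * (m%:R * (m%:R / M%:R)))) - 1).
Proof.
move=> nN mM b0 An Bm c1.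
set np := n%:R * (n%:R / N%:R) in c1 *; set mq := m%:R * (m%:R / M%:R).
have np0 : 0 <= np by rewrite mulr_ge0// divr_ge0.
have mq0 : 0 <= mq by rewrite mulr_ge0// divr_ge0.
rewrite exchange_big/=.
have s0 : 0 <= 3 * (np * b) by rewrite !mulr_ge0.
apply: (@le_trans _ _ (\sum_(B2 in draws M m) 'C(N, n)%:R *
    (expR (3 * (np * b) * #|B1 :&: B2|%:R) - 1))).
  rewrite big_mkcondr/=; apply: ler_sum => B2 _; case: ifPn => [bB|_]; last first.
    rewrite mulr_ge0// subr_ge0 -[leLHS]expR0 ler_expR mulr_ge0//.
  under eq_bigr do rewrite mulrAC.
  rewrite big_split/= sumr_const card_drawsE -[X in _ + X]mulr_natl mulrN mulr1.
  rewrite mulrBr mulr1 lerD2r.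
  apply: le_trans (sum_draws_expR A1 nN _) _; first by rewrite mulr_ge0.
  rewrite ler_wpM2l// ler_expR An -/np.
  have := expR_sub1_le (mulr_ge0 b0 (ler0n R #|B1 :&: B2|)) bB.
  by move/(ler_wpM2l np0)/le_trans; apply; lra.
rewrite -mulr_sumr -mulrA ler_wpM2l//.
rewrite big_split/= sumr_const card_drawsE -[X in _ + X]mulr_natl mulrN mulr1.
rewrite mulrBr mulr1 lerD2r.
apply: le_trans (sum_draws_expR B1 mM s0) _.
rewrite ler_wpM2l// ler_expR Bm -/mq.
have := expR_sub1_le s0 c1.
by move/(ler_wpM2l mq0)/le_trans; apply; lra.
Qed.

Local Open Scope classical_set_scope.
Local Open Scope ring_scope.

(** * Change of measure for shifted Gaussian matrices *)

Section density.
Context d (T : measurableType d) (R : realType).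
Variables (mu nu : {measure set T -> \bar R}) (g : T -> R).
Hypothesis mg : measurable_fun setT g.
Hypothesis g0 : forall x, 0 <= g x.
Hypothesis nuE : forall A, measurable A ->
  nu A = (\int[mu]_(x in A) (g x)%:E)%E.
Import HBNNSimple.
Local Open Scope ereal_scope.

(** Both sides are limits along simple functions increasing to [f], by monotone convergence; for
    indicators the equality is [nuE]. *)
Lemma ge0_integral_density (f : T -> \bar R) : (forall x, 0 <= f x) ->
  measurable_fun setT f -> \int[nu]_x f x = \int[mu]_x (f x * (g x)%:E).
Proof.
move=> f0 mf; pose h := nnsfun_approx measurableT mf.
have hf x : (EFin \o h n) x @[n --> \oo] --> f x.
  by apply: cvg_nnsfun_approx.
have -> : \int[nu]_x f x = lim (\int[nu]_x (EFin \o h n) x @[n --> \oo]).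
  under eq_integral => x _ do rewrite -(cvg_lim _ (hf x))//.
  apply: monotone_convergence => //.
  - by move=> n; apply/measurable_EFinP.
  - by move=> n x _ /=; rewrite lee_fin.
  - by move=> x _ a b ab; rewrite lee_fin; exact/lefP/nd_nnsfun_approx.
have hfg x : ((EFin \o h n) x * (g x)%:E) @[n --> \oo] --> f x * (g x)%:E.
  by apply: cvgeZr => //; exact: hf.
under eq_integral => x _ do rewrite -(cvg_lim _ (hfg x))//.
rewrite monotone_convergence//; last 3 first.
- by move=> n; apply: emeasurable_funM; apply/measurable_EFinP.
- by move=> n x _; rewrite mule_ge0//= lee_fin.
- move=> x _ a b ab; rewrite lee_wpmul2r ?lee_fin//.
  exact/lefP/nd_nnsfun_approx.
congr (limn _); apply/funext => n.
transitivity (\int[nu]_x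
   (\sum_(y \in range (h n)) (y * \1_(h n @^-1` [set y]) x)%:E)).
  by apply: eq_integral => t _; rewrite /= fimfunE -fsumEFin.
transitivity (\int[mu]_x (\sum_(y \in range (h n))
    (y * \1_(h n @^-1` [set y]) x)%:E * (g x)%:E)); last first.
  apply: eq_integral => x _.
  rewrite -ge0_mule_fsuml => [|y]; last exact: nnfun_muleindic_ge0.
  by rewrite fsumEFin // -(fimfunE _ x).
have mi r : measurable_fun setT (fun x => (r * \1_(h n @^-1` [set r]) x)%:E).
  by apply/measurable_EFinP; apply: measurable_funM.
rewrite ge0_integral_fsum//; last by move=> r x _; exact: nnfun_muleindic_ge0.
rewrite ge0_integral_fsum//; last 2 first.
- by move=> r; apply: emeasurable_funM => //; apply/measurable_EFinP.
- by move=> r x _; rewrite mule_ge0 ?lee_fin// ; exact: nnfun_muleindic_ge0.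
apply: eq_fsbigr => r; rewrite inE => -[t _ rE].
under eq_integral do rewrite EFinM.
rewrite integralZl_indic_nnsfun// integral_indic// setIT nuE//.
have r0 : (0 <= r)%R by rewrite -rE.
under [RHS]eq_integral do rewrite EFinM -muleA.
rewrite [RHS]ge0_integralZl//; last 2 first.
- by apply: emeasurable_funM; exact/measurable_EFinP.
- by move=> x _; rewrite mule_ge0// lee_fin.
congr (_ * _); rewrite integral_mkcond; apply: eq_integral => x _.
by rewrite epatch_indic muleC.
Qed.

End density.

Lemma ge0_integral_translation (R : realType) (c : R) (f : R -> \bar R) :
  (forall x, 0 <= f x)%E -> measurable_fun setT f ->
  (\int[lebesgue_measure]_x f (c + x)%R = \int[lebesgue_measure]_x f x)%E.
Proof.
move=> f0 mf.
pose t := (fun x : R => c + x) : measurableTypeR R -> measurableTypeR R.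
have mt : measurable_fun setT t by exact: measurable_funD.
pose nu := measure_function_pushforward__canonical__measure_function_Measure
  (@lebesgue_measure R) mt.
(* The image of Lebesgue measure under the translation agrees with it on half-open intervals, hence
   everywhere by uniqueness. *)
rewrite [RHS](eq_measure_integral nu); last first.
  move=> A mA _; apply: (@lebesgue_measure_unique _ nu) => // X [[u v] _ <-].
  rewrite /nu /= /pushforward /=.
  rewrite [X in _ = lebesgue_measure X](_ : _ = `]u - c, v - c]%classic); last first.
    apply/seteqP; split => x /=; rewrite !in_itv/= /t => /andP[? ?];
    by apply/andP; split; lra.
  rewrite !lebesgue_measure_itv/= !lte_fin ltrD2r; case: ifP => // _.
  by rewrite -!EFinD; congr EFin; lra.
by rewrite ge0_integral_pushforward.
Qed.

Lemma ge0_integral_normal_shift (R : realType) (c : R) (f : R -> \bar R) :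
  (forall x, 0 <= f x)%E -> measurable_fun setT f ->
  (\int[normal_prob 0 1]_x f (c + x)%R =
   \int[normal_prob 0 1]_x (f x * (expR (c * x - c ^+ 2 / 2))%:E))%E.
Proof.
move=> f0 mf.
have npE (g : R -> \bar R) : (forall x, 0 <= g x)%E -> measurable_fun setT g ->
  (\int[normal_prob 0 1]_x g x = \int[lebesgue_measure]_x (g x * (normal_pdf 0 1 x)%:E))%E.
  move=> g0 mg; apply: ge0_integral_density => //.
  - exact: measurable_normal_pdf.
  - by move=> x; exact: normal_pdf_ge0.
have me : measurable_fun setT (fun x : R => (expR (c * x - c ^+ 2 / 2))%:E).
  by apply/measurable_EFinP; apply: measurableT_comp => //; exact: measurable_funB.
have mt : measurable_fun setT (fun x : R => f (c + x)%R).
  by apply: measurableT_comp => //; exact: measurable_funD.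
rewrite npE// npE//; last 2 first.
- by move=> x; rewrite mule_ge0// lee_fin expR_ge0.
- exact: emeasurable_funM.
(* After translating the right side by [c], the exponential factor turns the Gaussian density at c +
   x into the density at x. *)
rewrite -[RHS](ge0_integral_translation c); last 2 first.
- by move=> x; rewrite !mule_ge0// lee_fin ?expR_ge0// normal_pdf_ge0.
- apply: emeasurable_funM; first exact: emeasurable_funM.
  by apply/measurable_EFinP; exact: measurable_normal_pdf.
apply: eq_integral => x _; rewrite -muleA -EFinM; congr (_ * _%:E)%E.
rewrite normal_pdfE ?oner_neq0// mulrCA -expRD; congr (_ * expR _).
by rewrite expr1n; lra.
Qed.

Section iid_shift.
Context d (T : measurableType d) (R : realType) (P : probability T R).

Lemma measurable_prod_tnth n (g : 'I_n -> T -> R) :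
  (forall i, measurable_fun setT (g i)) ->
  measurable_fun setT (fun x : n.-tuple T => \prod_(i < n) g i (tnth x i)).
Proof.
move=> mg; apply: measurable_prod => i _.
exact: (measurableT_comp (mg i) (measurable_tnth i)).
Qed.

Lemma measurable_map_tnth n (tau : 'I_n -> T -> T) :
  (forall i, measurable_fun setT (tau i)) ->
  measurable_fun setT (fun x : n.-tuple T => [tuple tau i (tnth x i) | i < n]).
Proof.
move=> mtau; apply/measurable_fun_tnthP => i.
rewrite [X in measurable_fun _ X](_ : _ = fun x : n.-tuple T => tau i (tnth x i)).
  exact: (measurableT_comp (mtau i) (measurable_tnth i)).
by apply/funext => x /=; rewrite tnth_mktuple.
Qed.

(** Densities of coordinatewise maps multiply: by Tonelli, the induction hypothesis treats the tail
    for a fixed head, and [H] then treats the head. The maps may differ between coordinates, and [T]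
    is general, so that the lemma serves first for the entries of a row and then for the rows. *)
Lemma ge0_integral_iid_shift n (tau : 'I_n -> T -> T) (g : 'I_n -> T -> R) :
  (forall i, measurable_fun setT (tau i)) ->
  (forall i, measurable_fun setT (g i)) -> (forall i x, 0 <= g i x) ->
  (forall i (f : T -> \bar R), (forall x, 0 <= f x)%E -> measurable_fun setT f ->
     (\int[P]_x f (tau i x) = \int[P]_x (f x * (g i x)%:E))%E) ->
  forall F : n.-tuple T -> \bar R, (forall x, 0 <= F x)%E -> measurable_fun setT F ->
  (\int[iid_prob P n]_x F [tuple tau i (tnth x i) | i < n] =
   \int[iid_prob P n]_x (F x * (\prod_(i < n) g i (tnth x i))%:E))%E.
Proof.
move=> mtau mg g0 H; elim: n tau g mtau mg g0 H => [|n IH] tau g mtau mg g0 H F F0 mF.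
  apply: eq_integral => x _; rewrite big_ord0 mule1; congr F.
  by rewrite [LHS]tuple0 [RHS]tuple0.
have mFg : measurable_fun setT
    (fun x : n.+1.-tuple T => F x * (\prod_(i < n.+1) g i (tnth x i))%:E)%E.
  apply: emeasurable_funM => //; apply/measurable_EFinP.
  by apply: measurable_prod_tnth => i; exact: mg.
have mFt : measurable_fun setT
    (fun x : n.+1.-tuple T => F [tuple tau i (tnth x i) | i < n.+1]).
  by apply: measurableT_comp => //; exact: measurable_map_tnth.
have mc : measurable_fun setT (@tuple_cons d T n) by exact: measurable_cons.
have mFc : measurable_fun setT (F \o @tuple_cons d T n).
  exact: measurableT_comp.
have p0 k (h : 'I_k -> T -> R) (x : k.-tuple T) : (forall i x, 0 <= h i x) ->
    0 <= \prod_(i < k) h i (tnth x i).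
  by move=> h0; apply: prodr_ge0.
pose g' (i : 'I_n) := g (lift ord0 i); pose tau' (i : 'I_n) := tau (lift ord0 i).
have mpg : measurable_fun setT (fun y : n.-tuple T => \prod_(i < n) g' i (tnth y i)).
  by apply: measurable_prod_tnth => i; exact: mg.
pose K z := ((F \o @tuple_cons d T n) z * (\prod_(i < n) g' i (tnth z.2 i))%:E)%E.
have mK : measurable_fun setT K.
  apply: emeasurable_funM => //; apply/measurable_EFinP.
  exact: measurableT_comp mpg measurable_snd.
have K0 z : (0 <= K z)%E.
  by apply: mule_ge0; rewrite ?lee_fin ?p0 //= => i x; exact: g0.
pose G x := (\int[iid_prob P n]_y K (x, y))%E.
rewrite /= ge0_integral_distribution// ge0_integral_distribution//; last first.
  by move=> x; apply: mule_ge0; rewrite ?lee_fin ?p0.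
rewrite fubini_tonelli1//=; last exact: measurableT_comp.
rewrite fubini_tonelli1//=; last 2 first.
- exact: (measurableT_comp mFg mc).
- by move=> x; apply: mule_ge0; rewrite ?lee_fin ?p0.
transitivity (\int[P]_x G (tau ord0 x))%E.
  apply: eq_integral => x _; rewrite /fubini_F /G /K /=.
  rewrite -(IH tau' g' (fun i => mtau _) (fun i => mg _) (fun i => g0 _)
    (fun i => H _) (fun y => F (tuple_cons (tau ord0 x, y))))//; last first.
    exact: (measurableT_comp mFc (pair1_measurable _)).
  apply: eq_integral => y _; congr F; apply: eq_from_tnth => i.
  rewrite tnth_mktuple /tuple_cons /=; have [j ->|->] := unliftP ord0 i; last by [].
  by rewrite !tnthS tnth_mktuple.
rewrite H; last 2 first.
- by move=> x; apply: integral_ge0.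
- exact: measurable_fun_fubini_tonelli_F.
apply: eq_integral => x _; rewrite /G -ge0_integralZr//; last 2 first.
- exact: (measurableT_comp mK (pair1_measurable _)).
- by rewrite lee_fin.
apply: eq_integral => y _; rewrite /K /= -muleA -EFinM; congr (_ * _%:E)%E.
rewrite big_ord_recl mulrC; congr (_ * _); apply: eq_bigr => i _.
by rewrite tnthS.
Qed.

End iid_shift.

Section girsanov.
Context (R : realType) (N M : nat).
Implicit Types S Y : 'M[R]_(N, M).

Definition log_lr S Y : R :=
  \sum_(i < N) \sum_(j < M) (S i j * Y i j - S i j ^+ 2 / 2).

Lemma measurable_log_lr S : measurable_fun setT (log_lr S).
Proof.
apply: measurable_sum => i; apply: measurable_sum => j.
by apply: measurable_funB => //; apply: measurable_funM => //; exact: measurable_entry.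
Qed.

(** Cameron-Martin formula: [expR (log_lr S Y)] is the likelihood ratio of P_S against P_0. *)
Lemma ge0_integral_gaussian_shift S (f : 'M[R]_(N, M) -> \bar R) :
  (forall Y, 0 <= f Y)%E -> measurable_fun setT f ->
  (\int[gaussian_noise R N M]_Y f (S + Y)%R =
   \int[gaussian_noise R N M]_Y (f Y * (expR (log_lr S Y))%:E))%E.
Proof.
move=> f0 mf.
have mS : measurable_fun setT (fun Y => f (S + Y)).
  apply: (measurableT_comp mf).
  exact: (@measurable_funPT _ _ _ _ (signal_plus_noise S)).
have me : measurable_fun setT (fun Y => (expR (log_lr S Y))%:E).
  apply/measurable_EFinP; apply: measurableT_comp => //; exact: measurable_log_lr.
have mmt : measurable_fun setT (@matrix_of_tuples R N M).
  exact: (@measurable_funPT _ _ _ _ (@matrix_of_tuples R N M)).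
rewrite /gaussian_noise !ge0_integral_distribution//; last 2 first.
- exact: emeasurable_funM.
- by move=> Y; rewrite mule_ge0// lee_fin expR_ge0.
pose g i j (x : measurableTypeR R) : R := expR (S i j * x - S i j ^+ 2 / 2).
have mg i j : measurable_fun setT (g i j).
  suff: measurable_fun setT (fun x : R => expR (S i j * x - S i j ^+ 2 / 2)) by [].
  by apply: measurableT_comp => //; exact: measurable_funB.
pose t i j (x : measurableTypeR R) : measurableTypeR R := S i j + x.
have mt i j : measurable_fun setT (t i j).
  suff: measurable_fun setT (fun x : R => S i j + x) by [].
  exact: measurable_funD.
pose tr i (y : M.-tuple (measurableTypeR R)) := [tuple t i j (tnth y j) | j < M].
pose gr i (y : M.-tuple (measurableTypeR R)) := \prod_(j < M) g i j (tnth y j).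
transitivity (\int[iid_prob (iid_prob (normal_prob 0 1) M) N]_x
   (f \o @matrix_of_tuples R N M) [tuple tr i (tnth x i) | i < N])%E.
  apply: eq_integral => x _ /=; congr f; apply/matrixP => i j.
  by rewrite !mxE !tnth_mktuple.
rewrite (@ge0_integral_iid_shift _ _ _ _ _ _ gr)//.
- apply: eq_integral => x _ /=; congr (_ * _%:E)%E.
  rewrite /log_lr expR_sum; apply: eq_bigr => i _.
  by rewrite expR_sum; apply: eq_bigr => j _; rewrite mxE.
- by move=> i; exact: measurable_map_tnth.
- by move=> i; exact: measurable_prod_tnth.
- by move=> i y; apply: prodr_ge0 => j _; exact: expR_ge0.
- move=> i h h0 mh; apply: ge0_integral_iid_shift => //.
  + by move=> j y; exact: expR_ge0.
  + by move=> j k k0 mk; exact: ge0_integral_normal_shift.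
- by move=> x; exact: f0.
- exact: (measurableT_comp mf mmt).
Qed.

Lemma integral_expR_log_lr S :
  (\int[gaussian_noise R N M]_Y (expR (log_lr S Y))%:E = 1)%E.
Proof.
under eq_integral => Y _ do rewrite -[(expR _)%:E]mul1e.
rewrite -(@ge0_integral_gaussian_shift S (cst 1%E))//=.
by rewrite integral_cst//= mul1e probability_setT.
Qed.

End girsanov.

(** * Truncated second moments *)

Section second_moment.
Context d (T : measurableType d) (R : realType) (P : probability T R).

Lemma ge0_integral_sum_in (I : finType) (D : {set I}) (f : I -> T -> R) :
  (forall i, measurable_fun setT (f i)) -> (forall i x, 0 <= f i x) ->
  (\int[P]_x (\sum_(i in D) f i x)%:E = \sum_(i in D) \int[P]_x (f i x)%:E)%E.
Proof.
move=> mf f0; under eq_integral do rewrite -sumEFin -big_enum.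
rewrite ge0_integral_sum//= ?big_enum// => [i|i x _].
  exact/measurable_EFinP.
by rewrite lee_fin.
Qed.

Lemma measurable_sum_in (I : finType) (D : {set I}) (f : I -> T -> R) :
  (forall i, measurable_fun setT (f i)) ->
  measurable_fun setT (fun x => \sum_(i in D) f i x).
Proof.
by move=> mf; under eq_fun do rewrite -big_enum; exact: measurable_sum.
Qed.

(** Abstract Bayesian bound: the [L i] are likelihood ratios, the [G i] truncations, and l is the
    average of [L i * G i] over [D]. The parameter [h] weighs the arithmetic-geometric mean
    inequality that bounds the first absolute moment of 1 - l by second moments. *)
Lemma second_moment_lower_bound (I : finType) (D : {set I}) (L G : I -> T -> R)
  (Q : I -> I -> R) (U Delta h alpha beta : R) (psi : T -> R) :
  D != finset.set0 ->
  (forall i, measurable_fun setT (L i)) -> (forall i, measurable_fun setT (G i)) ->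
  (forall i x, 0 <= L i x) -> (forall i x, 0 <= G i x <= 1) ->
  measurable_fun setT psi -> (forall x, 0 <= psi x <= 1) -> 0 < h ->
  (forall i, i \in D -> (1 - U)%:E <= \int[P]_x (L i x * G i x)%:E)%E ->
  (forall i j, i \in D -> j \in D ->
    (\int[P]_x (L i x * G i x * (L j x * G j x))%:E <= (Q i j)%:E)%E) ->
  (forall i, i \in D -> \sum_(j in D) Q i j <= #|D|%:R * (1 + Delta)) ->
  (\int[P]_x (psi x)%:E <= alpha%:E)%E ->
  (forall i, i \in D -> (\int[P]_x (L i x * (1 - psi x))%:E <= beta%:E)%E) ->
  1 - h / 2 - (Delta + 2 * U) / (2 * h) <= alpha + beta.
Proof.
move=> D0 mL mG L0 G01 mpsi psi01 h0 LG LGLG QD psia psib.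
pose c : R := #|D|%:R.
have c0 : 0 < c by rewrite ltr0n card_gt0.
(* [K] is opaque, so that [EFinD] does not split it. *)
have [K KE] : exists K, K = (2 * h)^-1 + h / 2 by exists ((2 * h)^-1 + h / 2).
have K0 : 0 <= K by rewrite KE addr_ge0// ?invr_ge0 ?divr_ge0// ?mulr_ge0// ltW.
pose w1 := (h * c)^-1; pose w2 := (2 * h * c ^+ 2)^-1.
have w10 : 0 <= w1 by rewrite invr_ge0 mulr_ge0// ltW.
have w20 : 0 <= w2 by rewrite invr_ge0 !mulr_ge0 ?exprn_ge0// ltW.
have c10 : 0 <= c^-1 by rewrite invr_ge0 ltW.
pose f1 i x := w1 * (L i x * G i x).
pose f2 i x := c^-1 * (L i x * (1 - psi x)).
pose f3 i j x := w2 * (L i x * G i x * (L j x * G j x)).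
have LG0 i x : 0 <= L i x * G i x by rewrite mulr_ge0//; case/andP: (G01 i x).
have f10 i x : 0 <= f1 i x by rewrite mulr_ge0.
have f20 i x : 0 <= f2 i x.
  by rewrite mulr_ge0// mulr_ge0// subr_ge0; case/andP: (psi01 x).
have f30 i j x : 0 <= f3 i j x by rewrite mulr_ge0// mulr_ge0.
have mLG i : measurable_fun setT (fun x => L i x * G i x) by exact: measurable_funM.
have mf1 i : measurable_fun setT (f1 i) by exact: measurable_funM.
have mf2 i : measurable_fun setT (f2 i).
  by apply: measurable_funM => //; apply: measurable_funM => //; exact: measurable_funB.
have mf3 i j : measurable_fun setT (f3 i j).
  by apply: measurable_funM => //; exact: measurable_funM.
(* The identity 1 - (1 - l)(1 - psi) = psi + l (1 - psi) is combined with (1 - l)(1 - psi) <= (1 -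
   l)^2 / (2h) + h / 2. The term - l / h of the expanded square goes to the left, so that every
   integrand is nonnegative. *)
have pointwise x : 1 + \sum_(i in D) f1 i x <=
    psi x + \sum_(i in D) f2 i x + \sum_(i in D) \sum_(j in D) f3 i j x + K.
  pose l := c^-1 * \sum_(i in D) L i x * G i x.
  have -> : \sum_(i in D) f1 i x = l / h.
    rewrite -mulr_sumr /l /w1 invfM; lra.
  have -> : \sum_(i in D) \sum_(j in D) f3 i j x = l ^+ 2 / (2 * h).
    under eq_bigr do rewrite -mulr_sumr -mulr_sumr.
    rewrite -mulr_sumr -mulr_suml /l /w2 exprMn !invfM exprVn expr2; lra.
  have l0 : 0 <= l by rewrite mulr_ge0// sumr_ge0.
  have : l * (1 - psi x) <= \sum_(i in D) f2 i x.
    rewrite -mulr_sumr -mulr_suml -[leLHS]mulrA ler_wpM2l// ler_wpM2r//.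
      by rewrite subr_ge0; case/andP: (psi01 x).
    by apply: ler_sum => i _; rewrite ler_piMr//; case/andP: (G01 i x).
  have /andP[p0 p1] := psi01 x.
  have hV : h * h^-1 = 1 by rewrite divff// gt_eqF.
  rewrite KE invfM; set v := h^-1 in hV *.
  have v0 : 0 < v by rewrite invr_gt0.
  (* AM-GM: [2 (1 - l) s <= (1 - l)^2 / h + h s^2] with [s = 1 - psi x] *)
  have key : (1 - l) * (1 - psi x) <= (v * (1 - l) ^+ 2 + h) / 2.
    have : 0 <= (v * (1 - l) - (1 - psi x)) ^+ 2 * h by rewrite mulr_ge0 ?sqr_ge0// ltW.
    rewrite (_ : _ * h = (h * v) * (v * (1 - l) ^+ 2) -
      2 * ((h * v) * ((1 - l) * (1 - psi x))) + (1 - psi x) ^+ 2 * h); last by ring.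
    rewrite hV !mul1r => ?.
    have : (1 - psi x) ^+ 2 * h <= h by rewrite -[leRHS]mul1r ler_pM2r//; nra.
    lra.
  nra.
have m1 : measurable_fun setT (fun x => \sum_(i in D) f1 i x).
  exact: measurable_sum_in.
have m2 : measurable_fun setT (fun x => \sum_(i in D) f2 i x).
  exact: measurable_sum_in.
have m3 : measurable_fun setT (fun x => \sum_(i in D) \sum_(j in D) f3 i j x).
  by apply: measurable_sum_in => i; exact: measurable_sum_in.
have : (\int[P]_x (1 + \sum_(i in D) f1 i x)%:E <=
  \int[P]_x (psi x + \sum_(i in D) f2 i x + \sum_(i in D) \sum_(j in D) f3 i j x + K)%:E)%E.
  apply: ge0_le_integral => //.
  - by move=> x _; rewrite lee_fin addr_ge0// sumr_ge0.
  - by apply/measurable_EFinP; exact: measurable_funD.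
  - apply/measurable_EFinP; apply: measurable_funD => //.
    by apply: measurable_funD => //; exact: measurable_funD.
  - by move=> x _; rewrite lee_fin.
have s20 x : 0 <= \sum_(i in D) f2 i x by exact: sumr_ge0.
have s30 i x : 0 <= \sum_(j in D) f3 i j x by exact: sumr_ge0.
have s30' x : 0 <= \sum_(i in D) \sum_(j in D) f3 i j x by exact: sumr_ge0.
have p0 x : 0 <= psi x by case/andP: (psi01 x).
have int1 (k : R) : (\int[P]_x k%:E = k%:E)%E.
  by rewrite integral_cst//= probability_setT mule1.
under eq_integral do rewrite EFinD.
under [X in (_ <= X)%E]eq_integral do rewrite !EFinD.
rewrite ge0_integralD//=; last 2 first.
- by move=> x _; rewrite lee_fin sumr_ge0.
- exact/measurable_EFinP.
rewrite ge0_integralD//=; last 2 first.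
- by move=> x _; rewrite -!EFinD lee_fin !addr_ge0.
- by apply: emeasurable_funD; [apply: emeasurable_funD|]; exact/measurable_EFinP.
rewrite ge0_integralD//=; last 4 first.
- by move=> x _; rewrite -!EFinD lee_fin !addr_ge0.
- by apply: emeasurable_funD; exact/measurable_EFinP.
- by move=> x _; rewrite lee_fin.
- exact/measurable_EFinP.
rewrite ge0_integralD//=; do ?[exact/measurable_EFinP|by move=> x _; rewrite lee_fin].
rewrite !int1 ge0_integral_sum_in// ge0_integral_sum_in//.
rewrite ge0_integral_sum_in//; last by move=> i; exact: measurable_sum_in.
have iscale (k : R) (f : T -> R) : 0 <= k -> measurable_fun setT f ->
    (forall x, 0 <= f x) ->
    (\int[P]_x (k * f x)%:E = k%:E * \int[P]_x (f x)%:E)%E.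
  move=> k0 mf f0; under eq_integral do rewrite EFinM.
  rewrite ge0_integralZl//; first exact/measurable_EFinP.
  by move=> x _; rewrite lee_fin.
have sumD (k : R) : (\sum_(i in D) k%:E = (c * k)%:E)%E.
  by rewrite sumEFin sumr_const mulr_natl.
have b1 : (((1 - U) / h)%:E <= \sum_(i in D) \int[P]_x (f1 i x)%:E)%E.
  rewrite (_ : (1 - U) / h = c * (w1 * (1 - U))); last first.
    by rewrite /w1 invfM; field; rewrite ?gt_eqF.
  rewrite -sumD; apply: lee_sum => i iD.
  by rewrite iscale// EFinM lee_wpmul2l ?lee_fin//; exact: LG.
have b2 : (\sum_(i in D) \int[P]_x (f2 i x)%:E <= beta%:E)%E.
  rewrite (_ : beta = c * (c^-1 * beta)); last by rewrite mulrA divff ?mul1r// gt_eqF.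
  rewrite -sumD; apply: lee_sum => i iD.
  rewrite iscale//.
  - by rewrite EFinM lee_wpmul2l ?lee_fin//; exact: psib.
  - by apply: measurable_funM => //; exact: measurable_funB.
  - by move=> x; rewrite mulr_ge0// subr_ge0; case/andP: (psi01 x).
have b3 : (\sum_(i in D) \int[P]_x (\sum_(j in D) f3 i j x)%:E <=
    ((1 + Delta) / (2 * h))%:E)%E.
  rewrite (_ : (1 + Delta) / (2 * h) = c * (w2 * (c * (1 + Delta)))); last first.
    by rewrite /w2; field; rewrite ?gt_eqF.
  rewrite -sumD; apply: lee_sum => i iD; rewrite ge0_integral_sum_in//.
  apply: (@le_trans _ _ (\sum_(j in D) (w2 * Q i j)%:E)%E).
    apply: lee_sum => j jD.
    rewrite iscale//.
    - by rewrite EFinM lee_wpmul2l ?lee_fin//; exact: LGLG.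
    - exact: measurable_funM.
    - by move=> x; rewrite mulr_ge0.
  by rewrite sumEFin lee_fin -mulr_sumr ler_wpM2l// QD.
move=> H; have {H} := le_trans (leeD (lexx 1%:E) b1)
  (le_trans H (leeD (leeD (leeD psia b2) b3) (lexx K%:E))).
rewrite -!EFinD lee_fin KE => H.
move: H; rewrite !invfM; lra.
Qed.
End second_moment.

(** * Products of factors in the unit interval *)

Section products_of_truncations.
Context {R : realType} {I : finType}.
Implicit Types (F : I -> R) (P : pred I).

(** A union bound for smooth indicators. The induction also carries that the partial product lies in
    the unit interval. *)
Lemma prod_ge_1Bsum P F : (forall i, 0 <= F i <= 1) ->
  1 - \sum_(i | P i) (1 - F i) <= \prod_(i | P i) F i.
Proof.
move=> F01.
suff [] : 1 - \sum_(i | P i) (1 - F i) <= \prod_(i | P i) F i /\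
          0 <= \prod_(i | P i) F i <= 1 by [].
elim/big_rec2: _ => [|i s p _ [sp /andP[p0 p1]]]; first by rewrite subr0 lexx ler01.
have /andP[Fi0 Fi1] := F01 i; split; first by nra.
by rewrite mulr_ge0//= mulr_ile1.
Qed.

Lemma prod_itv01 P F : (forall i, 0 <= F i <= 1) -> 0 <= \prod_(i | P i) F i <= 1.
Proof.
move=> F01; rewrite prodr_ge0 => [|i _]; last by case/andP: (F01 i).
by rewrite prodr_ile1// => i _; exact: F01.
Qed.

Lemma prod_le_factor P F i : (forall i, 0 <= F i <= 1) -> P i ->
  \prod_(i | P i) F i <= F i.
Proof.
move=> F01 Pi; rewrite (bigD1 i)//= ler_piMr//; first by case/andP: (F01 i).
by case/andP: (prod_itv01 (fun j => P j && (j != i)) F01).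
Qed.

End products_of_truncations.

(** * Frobenius inner product and Gaussian exponential moments *)

Section dot.
Context {R : realType} {N M : nat}.
Implicit Types (S U Y : 'M[R]_(N, M)) (V : {set 'I_N}) (W : {set 'I_M}).

Definition dot S Y : R := \sum_(i < N) \sum_(j < M) S i j * Y i j.

Lemma dotC S Y : dot S Y = dot Y S.
Proof. by do 2 (apply: eq_bigr => ? _); exact: mulrC. Qed.

Lemma dotDl S U Y : dot (S + U) Y = dot S Y + dot U Y.
Proof.
rewrite /dot -big_split/=; apply: eq_bigr => i _; rewrite -big_split/=.
by apply: eq_bigr => j _; rewrite mxE mulrDl.
Qed.

Lemma dotZl (k : R) S Y : dot (k *: S) Y = k * dot S Y.
Proof.
rewrite /dot mulr_sumr; apply: eq_bigr => i _; rewrite mulr_sumr.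
by apply: eq_bigr => j _; rewrite mxE mulrA.
Qed.

Lemma dot0l Y : dot 0 Y = 0.
Proof. by rewrite -(scale0r Y) dotZl mul0r. Qed.

Lemma dotDr S U Y : dot Y (S + U) = dot Y S + dot Y U.
Proof. by rewrite !(dotC Y) dotDl. Qed.

Lemma dotZr (k : R) S Y : dot S (k *: Y) = k * dot S Y.
Proof. by rewrite !(dotC S) dotZl. Qed.

Lemma log_lrE S Y : log_lr S Y = dot S Y - dot S S / 2.
Proof.
rewrite /log_lr /dot mulr_suml -sumrB; apply: eq_bigr => i _.
rewrite mulr_suml -sumrB; apply: eq_bigr => j _.
by rewrite expr2.
Qed.

Lemma measurable_dot S : measurable_fun setT (dot S).
Proof.
apply: measurable_sum => i; apply: measurable_sum => j.
by apply: measurable_funM => //; exact: measurable_entry.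
Qed.

(** Up to a constant factor the integrand is the likelihood ratio of [S], which has integral 1. *)
Lemma integral_expR_dot S (k : R) :
  (\int[gaussian_noise R N M]_Y (expR (dot S Y + k))%:E =
   (expR (dot S S / 2 + k))%:E)%E.
Proof.
have E Y : expR (dot S Y + k) = expR (dot S S / 2 + k) * expR (log_lr S Y).
  by rewrite -expRD log_lrE; congr expR; lra.
under eq_integral => Y _ do rewrite E EFinM.
rewrite ge0_integralZl//; last first.
  apply/measurable_EFinP; apply: measurableT_comp => //; exact: measurable_log_lr.
by rewrite integral_expR_log_lr mule1.
Qed.

Definition blk V W : 'M[R]_(N, M) :=
  \matrix_(i, j) ((i \in V) && (j \in W))%:R.

Lemma dot_blk V W V' W' :
  dot (blk V W) (blk V' W') = #|V :&: V'|%:R * #|W :&: W'|%:R.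
Proof.
have card_sum (T : finType) (X : {set T}) : #|X|%:R = \sum_i (i \in X)%:R :> R.
  by rewrite -sum1_card natr_sum big_mkcond; apply: eq_bigr => i _; case: (i \in X).
rewrite !card_sum big_distrlr; apply: eq_bigr => i _; apply: eq_bigr => j _.
rewrite !mxE !inE /= -!natrM.
by case: (i \in V); case: (j \in W); case: (i \in V'); case: (j \in W').
Qed.

End dot.

(** * The truncated likelihood ratio and its first two moments *)

Section truncated_likelihood.
Context {R : realType} {N M : nat}.
Variables (n m : nat) (a x y delta eps : R).
Hypotheses (a0 : 0 < a) (x0 : 0 <= x) (y0 : 0 <= y).
Hypotheses (e0 : 0 < eps) (d1 : 0 <= 1 - delta <= 1).
Hypothesis akl : forall k l, (k <= n)%N -> (l <= m)%N ->
  a ^+ 2 * k%:R * l%:R / 2 <= (1 - delta) * (k%:R * x + l%:R * y).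

Notation rectangle := ({set 'I_N} * {set 'I_M})%type.
Notation gn := (gaussian_noise R N M).
Implicit Types (AB VW : rectangle) (Y : 'M[R]_(N, M)).

Definition area AB : R := #|AB.1|%:R * #|AB.2|%:R.
Definition slack VW : R := #|VW.1|%:R * x + #|VW.2|%:R * y.
Definition capI AB VW : rectangle := (AB.1 :&: VW.1, AB.2 :&: VW.2)%SET.
Definition subI VW AB := (VW.1 \subset AB.1) && (VW.2 \subset AB.2).
(** If a side k of an overlap satisfies a^2 k <= 1, the untruncated exponential moment can be
    linearised; truncation is reserved for overlaps with both sides above 1 / a^2. *)
Definition large VW := (a ^- 2 < #|VW.1|%:R) && (a ^- 2 < #|VW.2|%:R).

Definition lr AB Y := expR (log_lr (a *: blk AB.1 AB.2) Y).

(** The first term is the mean of the sum over [VW] under the signal [a] on a rectangle containing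
    [VW]; the second is the safety margin. *)
Definition threshold VW : R := a * area VW + eps * slack VW / a.

(* A smooth substitute for the indicator of [dot (blk VW) Y <= threshold VW]: it
   lies below the exponential tilt with coefficient [a] used in the second
   moment, and its defect lies below every exponential used in the first. *)
Definition truncation1 VW Y : R :=
  Num.min 1 (expR (a * (threshold VW - dot (blk VW.1 VW.2) Y))).

Definition truncation AB Y : R :=
  \prod_(VW : rectangle | subI VW AB && large VW) truncation1 VW Y.

Lemma measurable_lr AB : measurable_fun setT (lr AB).
Proof. by apply: measurableT_comp => //; exact: measurable_log_lr. Qed.

Lemma measurable_truncation AB : measurable_fun setT (truncation AB).
Proof.
rewrite /truncation; under eq_fun do rewrite -big_filter.
apply: measurable_prod => VW _; apply: measurable_minr => //.
apply: measurableT_comp => //; apply: measurable_funM => //.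
by apply: measurable_funB => //; exact: measurable_dot.
Qed.

Lemma truncation1_itv VW Y : 0 <= truncation1 VW Y <= 1.
Proof. by rewrite /truncation1 le_min ler01 expR_ge0 ge_min lexx. Qed.

Lemma truncation_itv AB Y : 0 <= truncation AB Y <= 1.
Proof. by apply: prod_itv01 => VW; exact: truncation1_itv. Qed.

Lemma lrE AB Y : lr AB Y = expR (a * dot (blk AB.1 AB.2) Y - a ^+ 2 * area AB / 2).
Proof.
rewrite /lr log_lrE !dotZl dotZr dot_blk !finset.setIid /area; congr expR; lra.
Qed.

Lemma truncation1_ge VW Y (c : R) : 0 <= c ->
  1 - truncation1 VW Y <= expR (c * (dot (blk VW.1 VW.2) Y - threshold VW)).
Proof.
move=> c0; rewrite /truncation1; set z := _ - threshold _.
have -> : a * (threshold VW - dot (blk VW.1 VW.2) Y) = - (a * z) by rewrite /z; lra.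
have [z0|z0] := lerP z 0.
  rewrite (_ : Num.min _ _ = 1) ?subrr ?expR_ge0//.
  by apply/min_idPl; rewrite -[leLHS]expR0 ler_expR oppr_ge0 pmulr_rle0.
apply: (@le_trans _ _ 1); first by rewrite lerBlDr lerDl le_min ler01 expR_ge0.
by rewrite -[leLHS]expR0 ler_expR mulr_ge0// ltW.
Qed.

(** Since [slack] is additive in the two sides, the sum factors into one over [V] and one over
    [W]. *)
Lemma large_sum_le (eta : R) AB : 0 <= eta ->
  \sum_(VW : rectangle | subI VW AB && large VW) expR (- (eta * slack VW)) <=
  expR (#|AB.1|%:R * expR (- (eta * x / 2)) - eta * x * a ^- 2 / 2) *
  expR (#|AB.2|%:R * expR (- (eta * y / 2)) - eta * y * a ^- 2 / 2).
Proof.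
move=> eta0.
have h1 := @sum_large_subsets R _ AB.1 (a ^- 2) _ (mulr_ge0 eta0 x0).
have h2 := @sum_large_subsets R _ AB.2 (a ^- 2) _ (mulr_ge0 eta0 y0).
apply: le_trans (ler_pM _ _ h1 h2); do ?[by apply: sumr_ge0 => ? _; exact: expR_ge0].
rewrite big_distrlr/= pair_big/= le_eqVlt; apply/orP; left.
apply/eqP/eq_big => [[V W]|[V W] _] /=.
  by rewrite /subI /large/= andbACA.
by rewrite -expRD /slack/=; congr expR; lra.
Qed.

Lemma akl_index AB VW : #|AB.1| = n -> #|AB.2| = m -> subI VW AB ->
  a ^+ 2 * area VW / 2 <= (1 - delta) * slack VW.
Proof.
move=> An Bm /andP[/subset_leq_card VA /subset_leq_card WB].
by rewrite /area mulrA; apply: akl; rewrite -?An -?Bm.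
Qed.

Lemma slack_ge0 VW : 0 <= slack VW.
Proof. by rewrite addr_ge0// mulr_ge0. Qed.

(** Under the signal on [AB], the sum over [VW] is Gaussian with mean a area and variance area. With
    the tilt c = a eps / 2, the expected defect of each factor is at most exp(- eps^2 slack / 4),
    and these bounds are summed over all large subrectangles. *)
Lemma integral_lr_trunc_ge AB : #|AB.1| = n -> #|AB.2| = m ->
  ((1 - expR (n%:R * expR (- (eps ^+ 2 / 4 * x / 2)) - eps ^+ 2 / 4 * x * a ^- 2 / 2) *
       expR (m%:R * expR (- (eps ^+ 2 / 4 * y / 2)) - eps ^+ 2 / 4 * y * a ^- 2 / 2))%:E
   <= \int[gn]_Y (lr AB Y * truncation AB Y)%:E)%E.
Proof.
move=> An Bm; set eta := eps ^+ 2 / 4.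
(* The tilt [a * eps / 2] makes the union bound converge. *)
pose c := a * eps / 2.
pose E VW Y := lr AB Y * expR (c * (dot (blk VW.1 VW.2) Y - threshold VW)).
have E0 VW Y : 0 <= E VW Y by rewrite mulr_ge0 ?expR_ge0.
have mE VW : measurable_fun setT (E VW).
  apply: measurable_funM; first exact: measurable_lr.
  apply: measurableT_comp => //; apply: measurable_funM => //.
  by apply: measurable_funB => //; exact: measurable_dot.
have iE VW : subI VW AB -> (\int[gn]_Y (E VW Y)%:E <= (expR (- (eta * slack VW)))%:E)%E.
  move=> VWAB; have := akl_index An Bm VWAB; case/andP: VWAB => VA WB h.
  have EE Y : E VW Y = expR (dot (a *: blk AB.1 AB.2 + c *: blk VW.1 VW.2) Y +
      (- (a ^+ 2 * area AB / 2) - c * threshold VW)).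
    by rewrite /E lrE -expRD dotDl !dotZl; congr expR; lra.
  under eq_integral => Y _ do rewrite EE.
  rewrite integral_expR_dot lee_fin ler_expR.
  rewrite !(dotDl, dotDr, dotZl, dotZr) !dot_blk !finset.setIid.
  rewrite (finset.setIidPr VA) (finset.setIidPr WB) (finset.setIidPl VA) (finset.setIidPl WB).
  rewrite /threshold /area /c in h *; have := slack_ge0 VW; set s := slack VW in h *.
  have -> : a * eps / 2 * (a * (#|VW.1|%:R * #|VW.2|%:R) + eps * s / a) =
    a ^+ 2 * eps / 2 * (#|VW.1|%:R * #|VW.2|%:R) + eps ^+ 2 * s / 2.
    by field; rewrite gt_eqF.
  move: h; set k := _ * #|VW.2|%:R; set K := _ * #|AB.2|%:R => h s0.
  (* This caps the quadratic term c^2 area / 2 at eps^2 slack / 4, half of the linear gain c eps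
     slack / a = eps^2 slack / 2. *)
  have h' : a ^+ 2 * k / 2 <= s by apply: le_trans h _; rewrite ler_piMl//; case/andP: d1.
  have : 0 <= eps ^+ 2 * (s - a ^+ 2 * k / 2) by rewrite mulr_ge0 ?sqr_ge0// subr_ge0.
  rewrite /eta; lra.
pose D : {set rectangle} := [set VW | subI VW AB && large VW]%SET.
have : (\int[gn]_Y (lr AB Y)%:E <=
    \int[gn]_Y (lr AB Y * truncation AB Y + \sum_(VW in D) E VW Y)%:E)%E.
  apply: ge0_le_integral => //.
  - by move=> Y _; rewrite lee_fin expR_ge0.
  - by apply/measurable_EFinP; exact: measurable_lr.
  - apply/measurable_EFinP; apply: measurable_funD; last exact: measurable_sum_in.
    by apply: measurable_funM; [exact: measurable_lr|exact: measurable_truncation].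
  - move=> Y _; rewrite lee_fin.
    rewrite (eq_bigl (fun VW => subI VW AB && large VW)) => [|VW]; last by rewrite inE.
    have := prod_ge_1Bsum (fun VW => subI VW AB && large VW) (truncation1_itv ^~ Y).
    rewrite -/(truncation AB Y) => h; rewrite -mulr_sumr -mulrDr -[leLHS]mulr1.
    rewrite ler_wpM2l ?expR_ge0//; apply: (le_trans (y := truncation AB Y +
      \sum_(VW | subI VW AB && large VW) (1 - truncation1 VW Y))); first by lra.
    rewrite lerD2l; apply: ler_sum => VW _; apply: truncation1_ge.
    by rewrite /c divr_ge0// mulr_ge0// ltW.
rewrite integral_expR_log_lr.
under [X in (_ <= X)%E]eq_integral do rewrite EFinD.
rewrite ge0_integralD//=; last 4 first.
- by move=> Y _; rewrite lee_fin mulr_ge0 ?expR_ge0//; case/andP: (truncation_itv AB Y).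
- apply/measurable_EFinP.
  by apply: measurable_funM; [exact: measurable_lr|exact: measurable_truncation].
- by move=> Y _; rewrite lee_fin sumr_ge0.
- by apply/measurable_EFinP; exact: measurable_sum_in.
rewrite ge0_integral_sum_in// => h.
rewrite EFinB leeBlDr//; apply: (le_trans h); rewrite leeD2l//.
apply: (@le_trans _ _ (\sum_(VW in D) (expR (- (eta * slack VW)))%:E)%E).
  by apply: lee_sum => VW; rewrite inE => /andP[/iE].
have eta0 : 0 <= eta by rewrite divr_ge0 ?sqr_ge0.
have := large_sum_le AB eta0; rewrite An Bm sumEFin lee_fin; apply: le_trans.
by rewrite (eq_bigl (fun VW => subI VW AB && large VW))// => VW; rewrite inE.
Qed.

Definition second_moment_bound AB AB' : R :=
  let VW := capI AB AB' in
  if large VW then expR (a ^+ 2 * area VW / 2 + eps * slack VW)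
  else expR (a ^+ 2 * area VW).

(** Without truncation the exponent is a^2 area of the overlap. When the overlap is large, its own
    truncation factor is kept and bounded by the exponential tilt with coefficient - a, which leaves
    a^2 area / 2 + eps slack. *)
Lemma integral_lr_trunc_le AB AB' :
  (\int[gn]_Y (lr AB Y * truncation AB Y * (lr AB' Y * truncation AB' Y))%:E <=
   (second_moment_bound AB AB')%:E)%E.
Proof.
pose VW := capI AB AB'.
have mL : measurable_fun setT (fun Y =>
    (lr AB Y * truncation AB Y * (lr AB' Y * truncation AB' Y))%:E).
  apply/measurable_EFinP; apply: measurable_funM; apply: measurable_funM;
  by [exact: measurable_lr|exact: measurable_truncation].
have L0 Y : 0 <= lr AB Y * truncation AB Y * (lr AB' Y * truncation AB' Y).
  by rewrite !mulr_ge0 ?expR_ge0//;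
    [case/andP: (truncation_itv AB Y)|case/andP: (truncation_itv AB' Y)].
(* Any log-linear bound on the two truncations reduces the moment to an explicit Gaussian
   integral. *)
have step S (k : R) :
    (forall Y, truncation AB Y * truncation AB' Y <= expR (dot S Y + k)) ->
    (\int[gn]_Y (lr AB Y * truncation AB Y * (lr AB' Y * truncation AB' Y))%:E <=
     (expR (a ^+ 2 * area VW + a * dot (blk AB.1 AB.2) S + a * dot (blk AB'.1 AB'.2) S +
       dot S S / 2 + k))%:E)%E.
  move=> h; pose u := a *: blk AB.1 AB.2 + a *: blk AB'.1 AB'.2 + S.
  pose c := k - a ^+ 2 * area AB / 2 - a ^+ 2 * area AB' / 2.
  apply: (@le_trans _ _ (\int[gn]_Y (expR (dot u Y + c))%:E)%E).
    apply: ge0_le_integral => //.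
    - by move=> Y _; rewrite lee_fin.
    - apply/measurable_EFinP; apply: measurableT_comp => //.
      by apply: measurable_funD => //; exact: measurable_dot.
    - move=> Y _; rewrite lee_fin mulrACA !lrE -expRD.
      apply: le_trans (ler_wpM2l (expR_ge0 _) (h Y)) _; rewrite -expRD ler_expR.
      by rewrite /u /c !dotDl !dotZl; lra.
  rewrite integral_expR_dot lee_fin ler_expR /u /c.
  rewrite !(dotDl, dotDr, dotZl, dotZr) !dot_blk !finset.setIid.
  rewrite (dotC S (blk AB.1 AB.2)) (dotC S (blk AB'.1 AB'.2)) /area /VW /capI/=.
  rewrite (finset.setIC AB'.1) (finset.setIC AB'.2); lra.
rewrite /second_moment_bound -/VW; case: ifPn => lVW; last first.
  have := step 0 0; rewrite !(dotC _ 0) !dot0l !mul0r !mulr0 !addr0.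
  apply=> Y; rewrite dot0l addr0 expR0.
  have /andP[? ?] := truncation_itv AB Y.
  by have /andP[? ?] := truncation_itv AB' Y; rewrite mulr_ile1.
have sV : subI VW AB by rewrite /subI/= !finset.subsetIl.
apply: le_trans (step (- a *: blk VW.1 VW.2) (a * threshold VW) _) _.
  move=> Y; apply: (@le_trans _ _ (truncation AB Y)).
    have /andP[? ?] := truncation_itv AB Y; have /andP[? ?] := truncation_itv AB' Y.
    by rewrite ler_piMr.
  apply: (@le_trans _ _ (truncation1 VW Y)).
    apply: (prod_le_factor (P := fun VW => subI VW AB && large VW)
      (F := truncation1 ^~ Y)); last by rewrite sV.
    by move=> ?; exact: truncation1_itv.
  by rewrite /truncation1 ge_min ler_expR dotZl; apply/orP; right; lra.
rewrite lee_fin ler_expR !(dotZl, dotZr) !dot_blk.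
have /andP[/= VA WB] := sV.
rewrite (finset.setIidPr VA) (finset.setIidPr WB) !finset.setIid.
rewrite (finset.setIidPr (finset.subsetIr AB.1 AB'.1)).
rewrite (finset.setIidPr (finset.subsetIr AB.2 AB'.2)).
rewrite /threshold /area.
have -> : a * (a * (#|VW.1|%:R * #|VW.2|%:R) + eps * slack VW / a) =
  a ^+ 2 * (#|VW.1|%:R * #|VW.2|%:R) + eps * slack VW by field; rewrite gt_eqF.
by rewrite /=; lra.
Qed.

End truncated_likelihood.

(** A given [V] lies in the overlap with probability at most exp(- x #V). As eta + rho <= 1, this
    absorbs the weight exp(rho x #V) and leaves exp(- eta x #V) to be summed over the large
    subsets. *)
Lemma sum_draws_large (R : realType) (N n : nat) (A : {set 'I_N}) (K x rho eta : R) :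
  (0 < n <= N)%N -> 0 <= x -> 0 <= eta -> eta + rho <= 1 ->
  n%:R / N%:R = expR (- x) -> #|A| = n ->
  \sum_(A' in draws N n | K < #|A :&: A'|%:R) expR (rho * x * #|A :&: A'|%:R) <=
  'C(N, n)%:R * expR (n%:R * expR (- (eta * x / 2)) - eta * x * K / 2).
Proof.
move=> nN x0 eta0 er px An.
pose g (V : {set 'I_N}) : R := if K < #|V|%:R then expR (rho * x * #|V|%:R) else 0.
rewrite big_mkcondr/=.
apply: le_trans (sum_draws_capI nN A (g := g) _) _.
  by move=> V; rewrite /g; case: ifP => // _; exact: expR_ge0.
rewrite ler_wpM2l//.
apply: le_trans (_ : _ <= \sum_(V : {set 'I_N} | (V \subset A) && (K < #|V|%:R))
  expR (- (eta * x * #|V|%:R))) _; last first.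
  by rewrite -An; exact/sum_large_subsets/mulr_ge0.
rewrite [leRHS]big_mkcondr/=; apply: ler_sum => V _; rewrite /g px.
case: ifP => KV; last by rewrite mulr0.
rewrite -expRM_natr -expRD ler_expR.
have : 0 <= (1 - (eta + rho)) * (x * #|V|%:R) by rewrite !mulr_ge0// subr_ge0.
lra.
Qed.

(** * Bounds on the errors for fixed dimensions *)

Section finite_bound.
Context {R : realType} {N M : nat}.
Variables (n m : nat) (a x y delta eps eta : R).
Hypotheses (nN : (0 < n <= N)%N) (mM : (0 < m <= M)%N).
Hypotheses (a0 : 0 < a) (x0 : 0 <= x) (y0 : 0 <= y).
Hypotheses (e0 : 0 < eps) (d1 : 0 <= 1 - delta <= 1).
Hypothesis akl : forall k l, (k <= n)%N -> (l <= m)%N ->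
  a ^+ 2 * k%:R * l%:R / 2 <= (1 - delta) * (k%:R * x + l%:R * y).
Hypotheses (px : n%:R / N%:R = expR (- x)) (qy : m%:R / M%:R = expR (- y)).
Hypotheses (an : 3 * (n%:R * (n%:R / N%:R) * a ^+ 2) <= 1).
Hypotheses (am : 3 * (m%:R * (m%:R / M%:R) * a ^+ 2) <= 1).
Hypotheses (eta0 : 0 <= eta) (ed : eta + (1 - delta + eps) <= 1).

(** [tau] bounds the contribution of sides longer than 1 / a^2; [lambda] below bounds that of
    overlaps with a short side. *)
Let tau (k : nat) (z : R) := expR (k%:R * expR (- (eta * z / 2)) - eta * z * a ^- 2 / 2).
Let lambda := expR (9 * (a ^+ 2 * (n%:R * (n%:R / N%:R)) * (m%:R * (m%:R / M%:R)))) - 1.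

Definition rectangles : {set {set 'I_N} * {set 'I_M}} :=
  finset.setX (draws N n) (draws M m).

Lemma sum_rectangles (f : {set 'I_N} * {set 'I_M} -> R) :
  \sum_(AB in rectangles) f AB =
  \sum_(A in draws N n) \sum_(B in draws M m) f (A, B).
Proof. by rewrite pair_big_dep/=; apply: eq_big => [[A B]|[A B] _] //=; rewrite !inE. Qed.

Lemma card_rectangles : #|rectangles| = ('C(N, n) * 'C(M, m))%N.
Proof. by rewrite cardsX !card_drawsE. Qed.

Lemma sum_second_moment_bound (AB : {set 'I_N} * {set 'I_M}) : #|AB.1| = n -> #|AB.2| = m ->
  \sum_(AB' in rectangles) second_moment_bound a x y eps AB AB' <=
  #|rectangles|%:R * (1 + (2 * lambda + tau n x * tau m y)).
Proof.
case: AB => A B /= An Bm; pose rho := 1 - delta + eps; have ed' : eta + rho <= 1 by [].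
pose b := a ^+ 2; have b0 : 0 < b by rewrite exprn_gt0.
have small k : ~~ (a ^- 2 < k) = (b * k <= 1).
  by rewrite -leNgt -[a ^- 2]mul1r ler_pdivlMr// mulrC.
pose f1 A' B' : R := expR (b * #|A :&: A'|%:R * #|B :&: B'|%:R) - 1.
have f10 A' B' : 0 <= f1 A' B'.
  by rewrite subr_ge0 -[leLHS]expR0 ler_expR !mulr_ge0// ltW.
pose g1 A' := if a ^- 2 < #|A :&: A'|%:R then expR (rho * x * #|A :&: A'|%:R) else 0.
pose g2 B' := if a ^- 2 < #|B :&: B'|%:R then expR (rho * y * #|B :&: B'|%:R) else 0.
have g10 A' : 0 <= g1 A' by rewrite /g1; case: ifP => // _; exact: expR_ge0.
have g20 B' : 0 <= g2 B' by rewrite /g2; case: ifP => // _; exact: expR_ge0.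
rewrite sum_rectangles.
(* Overlaps are split into those with a short column side, those with a short row side, and those
   with both sides long. In the last case [akl] bounds the exponent by rho (k x + l y), which
   separates rows from columns. *)
apply: (@le_trans _ _ (\sum_(A' in draws N n) \sum_(B' in draws M m)
  (1 + (if b * #|B :&: B'|%:R <= 1 then f1 A' B' else 0) +
       (if b * #|A :&: A'|%:R <= 1 then f1 A' B' else 0) + g1 A' * g2 B'))).
  apply: ler_sum => A' _; apply: ler_sum => B' _.
  rewrite /second_moment_bound /large /capI /area /slack /= -!small.
  have := f10 A' B'; have := mulr_ge0 (g10 A') (g20 B'); rewrite /f1 /g1 /g2.
  set kA := #|A :&: A'|; set kB := #|B :&: B'|; rewrite mulrA.
  case: (a ^- 2 < kA%:R) => /=; case: (a ^- 2 < kB%:R) => /=; rewrite ?mulr0 ?mul0r; try lra.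
  move=> _ _; rewrite !addr0 -expRD; apply: ler_wpDl => //; rewrite ler_expR.
  have kAn : (kA <= n)%N by rewrite -An subset_leq_card// finset.subsetIl.
  have kBm : (kB <= m)%N by rewrite -Bm subset_leq_card// finset.subsetIl.
  have := akl kAn kBm; rewrite /rho; lra.
(* The short-row term is summed over [B'] outside, so that the bound on short overlaps applies with
   rows and columns interchanged. *)
have -> : \sum_(A' in draws N n) \sum_(B' in draws M m)
  (1 + (if b * #|B :&: B'|%:R <= 1 then f1 A' B' else 0) +
       (if b * #|A :&: A'|%:R <= 1 then f1 A' B' else 0) + g1 A' * g2 B') =
  'C(N, n)%:R * 'C(M, m)%:R +
  \sum_(A' in draws N n) \sum_(B' in draws M m | b * #|B :&: B'|%:R <= 1) f1 A' B' +
  \sum_(B' in draws M m) \sum_(A' in draws N n | b * #|A :&: A'|%:R <= 1) f1 A' B' +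
  (\sum_(A' in draws N n) g1 A') * (\sum_(B' in draws M m) g2 B').
  rewrite big_distrlr/=.
  rewrite [X in _ = _ + X + _](_ : _ = \sum_(A' in draws N n) \sum_(B' in draws M m)
     (if b * #|A :&: A'|%:R <= 1 then f1 A' B' else 0)); last first.
    by rewrite [RHS]exchange_big/=; apply: eq_bigr => B' _; rewrite big_mkcondr.
  rewrite [X in _ = X + _ + _ + _](_ : _ =
    \sum_(A' in draws N n) \sum_(B' in draws M m) 1); last first.
    by rewrite !sumr_const !card_drawsE -mulrnA -natrM mulnC.
  rewrite -!big_split/=; apply: eq_bigr => A' _.
  by rewrite big_mkcondr/= -!big_split.
have H1 := sum_draws_expR_mul nN mM (ltW b0) An Bm an.
have H2 := sum_draws_expR_mul mM nN (ltW b0) Bm An am.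
have H3 := sum_draws_large (a ^- 2) nN x0 eta0 ed' px An.
have H4 := sum_draws_large (a ^- 2) mM y0 eta0 ed' qy Bm.
rewrite big_mkcondr/= -/(g1 _) in H3; rewrite big_mkcondr/= in H4.
have {H3 H4} H34 := ler_pM (sumr_ge0 _ (fun A' _ => g10 A'))
  (sumr_ge0 _ (fun B' _ => g20 B')) H3 H4.
have {}H2 : \sum_(B' in draws M m) \sum_(A' in draws N n | b * #|A :&: A'|%:R <= 1) f1 A' B'
   <= 'C(N, n)%:R * 'C(M, m)%:R * lambda.
  move: H2; rewrite (mulrC 'C(M, m)%:R) [X in 9 * X]mulrAC; apply: le_trans.
  apply: ler_sum => B' _; apply: ler_sum => A' _.
  by rewrite /f1 -mulrAC.
rewrite card_rectangles natrM.
move: H1 H2 H34; rewrite -/lambda /tau /f1 /b; lra.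
Qed.

Lemma errors_ge (psi : 'M[R]_(N, M) -> R) (h alpha beta : R) :
  is_test psi -> 0 < h -> eta = eps ^+ 2 / 4 ->
  (type1_error psi <= alpha%:E)%E -> (type2_error n m a psi <= beta%:E)%E ->
  1 - h / 2 - (2 * lambda + 3 * (tau n x * tau m y)) / (2 * h) <= alpha + beta.
Proof.
move=> [mpsi psi01] h0 etaE t1 t2.
have p0 Y : 0 <= psi Y by case/andP: (psi01 Y).
have p1 Y : 0 <= 1 - psi Y by rewrite subr_ge0; case/andP: (psi01 Y).
have shift S (f : 'M[R]_(N, M) -> R) : measurable_fun setT f -> (forall Y, 0 <= f Y) ->
    ('E_(observation_law S)[f] = \int[gaussian_noise R N M]_Y (expR (log_lr S Y) * f Y)%:E)%E.
  move=> mf f0; have mEf : measurable_fun setT (EFin \o f) by exact/measurable_EFinP.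
  have f0' Y : (0 <= (EFin \o f) Y)%E by rewrite lee_fin.
  rewrite unlock /observation_law (ge0_integral_distribution _ mEf f0').
  rewrite (ge0_integral_gaussian_shift S f0' mEf).
  by apply: eq_integral => Y _; rewrite EFinM muleC.
(* This is Delta + 2 U, with U = tau n x * tau m y the defect of the first moment and Delta = 2
   lambda + U the excess of the second. *)
have -> : 2 * lambda + 3 * (tau n x * tau m y) =
  (2 * lambda + tau n x * tau m y) + 2 * (tau n x * tau m y) by lra.
apply: (@second_moment_lower_bound _ _ _ (gaussian_noise R N M) _ rectangles
  (lr a) (truncation a x y eps) (second_moment_bound a x y eps) _ _ _ _ _ psi) => //.
- rewrite -card_gt0 card_rectangles muln_gt0 !bin_gt0.
  by case/andP: nN => _ ->; case/andP: mM => _ ->.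
- by move=> AB; exact: measurable_lr.
- by move=> AB; exact: measurable_truncation.
- by move=> AB Y; exact: expR_ge0.
- by move=> AB Y; exact: truncation_itv.
- move=> AB; rewrite !inE => /andP[/eqP An /eqP Bm].
  by have := integral_lr_trunc_ge a0 x0 y0 e0 d1 akl An Bm; rewrite -etaE.
- by move=> AB AB' _ _; exact: integral_lr_trunc_le.
- by move=> AB; rewrite !inE => /andP[/eqP An /eqP Bm]; exact: sum_second_moment_bound.
- apply: le_trans t1; rewrite /type1_error shift//.
  rewrite le_eqVlt; apply/orP; left; apply/eqP; apply: eq_integral => Y _.
  by rewrite log_lrE !dot0l mul0r subr0 expR0 mul1r.
- move=> AB; rewrite !inE => /andP[/eqP An /eqP Bm]; apply: le_trans t2.
  apply: ereal_sup_ubound; exists (a *: blk AB.1 AB.2).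
    exists (finset.setX AB.1 AB.2); first by exists AB.1, AB.2.
    split=> i j; rewrite !inE !mxE.
      by move/negbTE => ->; rewrite mulr0.
    by move=> ->; rewrite mulr1.
  by rewrite shift//; exact: measurable_funB.
Qed.

End finite_bound.

(** * Asymptotics *)

Section asymptotics.
Context {R : realType}.
Implicit Types (u v x y : nat -> R).

Lemma limn_esup_lt_near u (l : R) : (limn_esup (fun k => (u k)%:E) < l%:E)%E ->
  exists2 c, c < l & \forall k \near \oo, u k <= c.
Proof.
move=> /ereal_inf_lt[_ [V VF <-]] supl.
have uV k : V k -> ((u k)%:E <= ereal_sup [set (u i)%:E | i in V])%E.
  by move=> Vk; apply: ereal_sup_ubound; exists k.
move: supl uV; case: ereal_sup => [r| |] //.
  rewrite lte_fin => rl uV; exists r => //.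
  by apply: filterS VF => k /uV; rewrite lee_fin.
(* A supremum equal to -oo leaves no index in [V], so any value below [l] serves. *)
move=> _ uV; exists (l - 1); first lra.
by apply: filterS VF => k /uV.
Qed.

Lemma same_order_near u v : (\forall k \near \oo, 0 < v k) -> same_order u v ->
  exists2 K, 0 < K & \forall k \near \oo, u k <= K * v k /\ v k <= K * u k.
Proof.
move=> v0 [c [C [c0 cu uC]]].
have /limn_esup_lt_near[C' _ uC'] :
    (limn_esup (fun k => (u k / v k)%:E) < (C + 1)%:E)%E.
  by apply: le_lt_trans uC _; rewrite lte_fin ltrDl.
(* The lower bound on the liminf is read as an upper bound on the limsup of the opposite
   sequence. *)
have /limn_esup_lt_near[c' c'0 uc'] :
    (limn_esup (fun k => (- (u k / v k))%:E) < (- (c / 2))%:E)%E.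
  rewrite EFinN lteNr; apply: lt_le_trans cu; rewrite lte_fin.
  lra.
exists (Num.max 1 (Num.max C' (2 / c))); first by rewrite lt_max ltr01.
near=> k.
have vk : 0 < v k by near: k.
have h1 : u k / v k <= C' by near: k.
have h2 : - (u k / v k) <= c' by near: k.
have {}h2 : c / 2 <= u k / v k by lra.
have uk : 0 <= u k.
  have : 0 <= u k / v k by apply: le_trans h2; rewrite divr_ge0// ltW.
  by rewrite pmulr_lge0// invr_gt0.
rewrite ler_pdivrMr// in h1; rewrite ler_pdivlMr// in h2.
split.
  by apply: le_trans h1 _; rewrite ler_wpM2r ?(ltW vk)// !le_max lexx /= orbT.
apply: le_trans (_ : v k <= 2 / c * u k) _.
  by rewrite mulrAC ler_pdivlMr//; lra.
by rewrite ler_wpM2r// !le_max lexx !orbT.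
Unshelve. all: by end_near. Qed.

Lemma cvg_ereal_of_le (u : nat -> \bar R) (l : R) : (forall k, u k <= l%:E)%E ->
  (forall e, 0 < e -> \forall k \near \oo, ((l - e)%:E <= u k)%E) ->
  u k @[k --> \oo] --> l%:E.
Proof.
move=> ul lu; apply/fine_cvgP; split.
  apply: filterS (lu 1 ltr01) => k luk.
  rewrite fin_numElt (lt_le_trans _ luk) ?ltNyr//=.
  by rewrite (le_lt_trans (ul k))// ltry.
apply/cvgrPdist_le => e e0; apply: filterS (lu e e0) => k luk.
have := ul k; move: luk; rewrite /=; case: (u k) => [r| |] //=.
by rewrite !lee_fin => h1 h2; rewrite ger0_norm; lra.
Qed.

(** Since ln y = o(x), eventually ln y <= c x / 2, and the product is at most exp(- c x / 2). *)
Lemma poly_expR_small x y (c e : R) : 0 < c -> 0 < e ->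
  x k @[k --> \oo] --> +oo -> y k @[k --> \oo] --> +oo ->
  ln (y k) / x k @[k --> \oo] --> (0 : R) ->
  \forall k \near \oo, y k * expR (- (c * x k)) <= e.
Proof.
move=> c0 e0 xoo yoo /cvgrPdist_le yx.
near=> k.
have xk : 0 < x k by near: k; exact: (cvgryPgt _).1.
have yk : 0 < y k by near: k; exact: (cvgryPgt _).1.
have h : ln (y k) <= c / 2 * x k.
  rewrite -ler_pdivrMr//; apply: le_trans (ler_norm _) _.
  by rewrite -normrN -sub0r; near: k; apply: yx; rewrite divr_gt0.
have xe : - ln e / (c / 2) <= x k by near: k; exact: (cvgryPge _).1.
rewrite ler_pdivrMr ?divr_gt0// in xe.
rewrite -[y k]lnK ?posrE// -[e]lnK ?posrE// -expRD ler_expR; lra.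
Unshelve. all: by end_near. Qed.

(** With b = a^2, the bound b n <= K y makes the negative term at least eta n x / (2 K y). As y
    exp(- eta x / 2) is small and x >= 1, the entropy term n exp(- eta x / 2) is at most half of
    that. The remaining exponent is at most - eta n x / (4 K y) <= - eta m / (4 K^2), which tends to
    -oo. *)
Lemma tau_small (n m : nat -> nat) x y b (K eta e : R) :
  0 < K -> 0 < eta -> 0 < e ->
  x k @[k --> \oo] --> +oo -> y k @[k --> \oo] --> +oo ->
  ln (y k) / x k @[k --> \oo] --> (0 : R) ->
  m k @[k --> \oo] --> \oo ->
  (\forall k \near \oo, 0 < b k /\ b k * (n k)%:R <= K * y k /\
     (m k)%:R * y k <= K * ((n k)%:R * x k)) ->
  \forall k \near \oo,
    expR ((n k)%:R * expR (- (eta * x k / 2)) - eta * x k / b k / 2) <= e.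
Proof.
move=> K0 eta0 e0 xoo yoo yx moo bK.
have c0 : 0 < eta / (4 * K) by rewrite divr_gt0// mulr_gt0.
have c1 : 0 < eta / (4 * K ^+ 2) by rewrite divr_gt0// mulr_gt0// exprn_gt0.
have small := poly_expR_small (divr_gt0 eta0 (ltr0Sn R 1)) c0 xoo yoo yx.
near=> k.
have [b0 [bn my]] : 0 < b k /\ b k * (n k)%:R <= K * y k /\
     (m k)%:R * y k <= K * ((n k)%:R * x k) by near: k.
have x1 : 1 <= x k by near: k; exact: (cvgryPge _).1.
have y0 : 0 < y k by near: k; exact: (cvgryPgt _).1.
have hs : y k * expR (- (eta / 2 * x k)) <= eta / (4 * K) by near: k.
have hm : - ln e / (eta / (4 * K ^+ 2)) <= (m k)%:R.
  by near: k; exact: ((cvgryPge _).1 ((cvgrnyP _).2 moo)).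
rewrite ler_pdivrMr// in hm.
rewrite -[e]lnK ?posrE// ler_expR.
set E := expR (- (eta * x k / 2)).
have {hs}s1 : (n k)%:R * E <= eta * ((n k)%:R * x k / y k) / (4 * K).
  have : E <= eta / (4 * K) / y k.
    rewrite ler_pdivlMr// mulrC; apply: le_trans hs.
    by rewrite ler_pM2l// ler_expR; lra.
  move=> /(ler_wpM2l (ler0n R (n k)))/le_trans; apply.
  have -> : (n k)%:R * (eta / (4 * K) / y k) = eta * ((n k)%:R * 1 / y k) / (4 * K).
    by rewrite mulr1; field; rewrite !gt_eqF.
  rewrite ler_pM2r ?invr_gt0 ?mulr_gt0// ler_pM2l// ler_pM2r ?invr_gt0//.
  by rewrite ler_wpM2l.
have s2 : (n k)%:R / y k / K <= (b k)^-1.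
  rewrite -[leRHS]mul1r ler_pdivlMr// mulrC mulrA ler_pdivrMr// mul1r mulrA.
  by rewrite ler_pdivrMr// mulrC.
have s3 : (m k)%:R / K <= (n k)%:R * x k / y k.
  by rewrite ler_pdivrMr// mulrAC ler_pdivlMr// (mulrC _ K).
have {}s2 : eta * x k * ((n k)%:R / y k / K) / 2 <= eta * x k / b k / 2.
  by rewrite ler_pM2r// ler_pM2l// mulr_gt0//; lra.
have {}s3 : eta / (4 * K) * ((m k)%:R / K) <= eta / (4 * K) * ((n k)%:R * x k / y k).
  by rewrite ler_pM2l.
have K1 : K * K^-1 = 1 by rewrite divff// gt_eqF.
have i4 : (4 * K)^-1 = K^-1 / 4 by rewrite invfM mulrC.
have i42 : (4 * K ^+ 2)^-1 = K^-1 * K^-1 / 4 by rewrite expr2 !invfM mulrC.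
move: s1 s2 s3 hm; rewrite i4 i42; lra.
Unshelve. all: by end_near. Qed.

End asymptotics.

Lemma cvg_ln_inv (R : realType) (p : nat -> R) : (forall k, 0 < p k) ->
  p k @[k --> \oo] --> (0 : R) -> ln (p k)^-1 @[k --> \oo] --> +oo.
Proof.
move=> p0 /cvgrPdist_le pc; apply/cvgryPge => A.
apply: filterS (pc (expR (- A)) (expR_gt0 _)) => k.
rewrite sub0r normrN ger0_norm ?(ltW (p0 k))// => pA.
by rewrite lnV ?posrE// lerNr -[leRHS]expRK ler_ln ?posrE// expR_gt0.
Qed.

(** * From bounds on single tests to the minimax quantities *)

Section constant_tests.
Context {R : realType} {N M : nat}.
Implicit Type c : R.

Lemma is_test_cst c : 0 <= c <= 1 -> is_test (fun _ : 'M[R]_(N, M) => c).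
Proof. by split. Qed.

Lemma type1_error_cst c : type1_error (fun _ : 'M[R]_(N, M) => c) = c%:E.
Proof. exact: expectation_cst. Qed.

Lemma type2_error_cst n m a c :
  (type2_error n m a (fun _ : 'M[R]_(N, M) => c) <= (1 - c)%:E)%E.
Proof.
apply: ge_ereal_sup => _ [S _ <-].
by rewrite (expectation_cst (observation_law S) (1 - c)).
Qed.

End constant_tests.

Lemma minimax_bounds (R : realType) (N M n m : nat) (a e : R) :
  (forall (psi : 'M[R]_(N, M) -> R) (alpha beta : R), is_test psi ->
    (type1_error psi <= alpha%:E)%E -> (type2_error n m a psi <= beta%:E)%E ->
    1 - e <= alpha + beta) ->
  ((1 - e)%:E <= minimax_risk R N M n m a)%E /\
  (forall alpha, ((1 - alpha - e)%:E <= minimax_type2_error R N M n m a alpha)%E).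
Proof.
move=> H.
have H' (psi : 'M[R]_(N, M) -> R) alpha : is_test psi -> (type1_error psi <= alpha%:E)%E ->
    ((1 - alpha - e)%:E <= type2_error n m a psi)%E.
  move=> tpsi t1; move: (H psi alpha ^~ tpsi) => /(_ _ t1).
  case: type2_error => [r| |] h //; last 2 first.
  - by rewrite leey.
  (* A type II error of -oo would allow beta = - e - alpha, that is, 1 - e <= - e. *)
  - by exfalso; have := h (- e - alpha) (leNye _); lra.
  by rewrite lee_fin; have := h r (lexx _); lra.
split; last by move=> alpha; apply: le_ereal_inf_tmp => _ [psi [tpsi t1] <-]; exact: H'.
apply: le_ereal_inf_tmp => _ [psi tpsi <-].
have [mpsi psi01] := tpsi.
have t1 : (type1_error psi <= 1)%E.
  rewrite -(@type1_error_cst R N M 1) /type1_error unlock; apply: ge0_le_integral => //.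
  - by move=> Y _; rewrite lee_fin; case/andP: (psi01 Y).
  - exact/measurable_EFinP.
  - by move=> Y _; rewrite lee_fin; case/andP: (psi01 Y).
have t0 : (0 <= type1_error psi)%E.
  rewrite /type1_error unlock; apply: integral_ge0 => Y _.
  by rewrite lee_fin; case/andP: (psi01 Y).
move: (H' psi ^~ tpsi) t0 t1; case: type1_error => [r| |] //= h _ _.
have := leeD2l r%:E (h r (lexx _)); apply: le_trans.
by rewrite -EFinD lee_fin; lra.
Qed.

(** The upper bounds come from the constant tests 0 and [alpha]; the hypothesis supplies the
    matching lower bounds. *)
Lemma cvg_minimax (R : realType) (N M n m : nat -> nat) (a : nat -> R) :
  (forall e, 0 < e -> \forall k \near \oo,
    forall (psi : 'M[R]_(N k, M k) -> R) (alpha beta : R), is_test psi ->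
    (type1_error psi <= alpha%:E)%E -> (type2_error (n k) (m k) (a k) psi <= beta%:E)%E ->
    1 - e <= alpha + beta) ->
  (minimax_risk R (N k) (M k) (n k) (m k) (a k) @[k --> \oo] --> 1%E) /\
  (forall alpha : R, 0 < alpha < 1 ->
     minimax_type2_error R (N k) (M k) (n k) (m k) (a k) alpha @[k --> \oo]
       --> (1 - alpha)%:E).
Proof.
move=> H; split => [|alpha /andP[al0 al1]]; apply: cvg_ereal_of_le.
- move=> k; apply: (@le_trans _ _ (type1_error (fun _ : 'M[R]_(N k, M k) => 0%R : R) +
    type2_error (n k) (m k) (a k) (fun _ : 'M[R]_(N k, M k) => 0%R : R))%E).
    apply: ereal_inf_lbound; exists (fun=> 0) => //.
    by apply: is_test_cst; rewrite lexx ler01.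
  by rewrite type1_error_cst add0e -[X in X%:E]subr0 type2_error_cst.
- by move=> e /H; apply: filterS => k /minimax_bounds[].
- move=> k; apply: (@le_trans _ _
    (type2_error (n k) (m k) (a k) (fun _ : 'M[R]_(N k, M k) => alpha))); last first.
    exact: type2_error_cst.
  apply: ereal_inf_lbound; exists (fun=> alpha) => //; split.
    by apply: is_test_cst; rewrite !ltW.
  by rewrite type1_error_cst.
- by move=> e /H; apply: filterS => k /minimax_bounds[_ /(_ alpha)].
Qed.

(** * Choice of the constants and passage to the limit *)

Unset Implicit Arguments.
Set Strict Implicit.
Set Printing Implicit Defensive.

Theorem theorem2p2 (R : realType) (N M n m : nat -> nat) (a p q : nat -> R)
  (n_range : forall k, (1 <= n k <= N k)%N)
  (m_range : forall k, (1 <= m k <= M k)%N)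
  (a_gt0 : forall k, 0 < a k)
  (pE : forall k, p k = (n k)%:R / (N k)%:R)
  (qE : forall k, q k = (m k)%:R / (M k)%:R)
  (N_oo : N k @[k --> \oo] --> \oo)
  (M_oo : M k @[k --> \oo] --> \oo)
  (n_oo : n k @[k --> \oo] --> \oo)
  (m_oo : m k @[k --> \oo] --> \oo)
  (p_0 : p k @[k --> \oo] --> (0 : R))
  (q_0 : q k @[k --> \oo] --> (0 : R))
  (pq_log : ln (ln (p k)^-1) / ln (q k)^-1 @[k --> \oo] --> (0 : R))
  (qp_log : ln (ln (q k)^-1) / ln (p k)^-1 @[k --> \oo] --> (0 : R))
  (nm_order : same_order (fun k => (n k)%:R * ln (p k)^-1)
                         (fun k => (m k)%:R * ln (q k)^-1))
  (a_small : a k ^+ 2 * (n k)%:R * (m k)%:R * p k * q k @[k --> \oo]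
               --> (0 : R))
  (a_limsup : (limn_esup (fun k => (a k ^+ 2 * (n k)%:R * (m k)%:R /
      (2 * ((n k)%:R * ln (p k)^-1 + (m k)%:R * ln (q k)^-1)))%:E) < 1)%E) :
  (minimax_risk R (N k) (M k) (n k) (m k) (a k) @[k --> \oo] --> 1%E) /\
  (forall alpha : R, 0 < alpha < 1 ->
     minimax_type2_error R (N k) (M k) (n k) (m k) (a k) alpha @[k --> \oo]
       --> (1 - alpha)%:E).
Proof.
have frac0 (i j : nat) : (1 <= i <= j)%N -> 0 < (i%:R / j%:R : R) <= 1.
  move=> /andP[i0 ij]; have j0 : (0 < j)%N by lia.
  by rewrite divr_gt0 ?ltr0n// ler_pdivrMr ?ltr0n// mul1r ler_nat.
have p01 k : 0 < p k <= 1 by rewrite pE frac0.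
have q01 k : 0 < q k <= 1 by rewrite qE frac0.
have p_gt0 k : 0 < p k by case/andP: (p01 k).
have q_gt0 k : 0 < q k by case/andP: (q01 k).
pose x k := ln (p k)^-1; pose y k := ln (q k)^-1.
have xoo : x k @[k --> \oo] --> +oo by exact: cvg_ln_inv.
have yoo : y k @[k --> \oo] --> +oo by exact: cvg_ln_inv.
have px k : p k = expR (- x k) by rewrite /x lnV ?posrE// opprK lnK ?posrE.
have qy k : q k = expR (- y k) by rewrite /y lnV ?posrE// opprK lnK ?posrE.
have n0 k : 0 < (n k)%:R :> R by rewrite ltr0n; case/andP: (n_range k).
have m0 k : 0 < (m k)%:R :> R by rewrite ltr0n; case/andP: (m_range k).
have x1 : \forall k \near \oo, 1 <= x k by exact: (cvgryPge _).1.
have y1 : \forall k \near \oo, 1 <= y k by exact: (cvgryPge _).1.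
have my0 : \forall k \near \oo, 0 < (m k)%:R * y k.
  by apply: filterS y1 => k yk; rewrite mulr_gt0//; lra.
have [K1 K10 nxmy] := same_order_near my0 nm_order.
have [c c1 uc] := limn_esup_lt_near a_limsup.
(* The maximum with 0 keeps 1 - delta in [0, 1) even if [c] is negative. *)
pose delta := 1 - Num.max 0 c.
have delta0 : 0 < delta by rewrite subr_gt0 gt_max ltr01.
have delta1 : delta <= 1 by rewrite lerBlDr lerDl le_max lexx.
have akm : \forall k \near \oo, a k ^+ 2 * (n k)%:R * (m k)%:R / 2 <=
    (1 - delta) * ((n k)%:R * x k + (m k)%:R * y k).
  near=> k.
  have xk : 1 <= x k by near: k.
  have yk : 1 <= y k by near: k.
  have s0 : 0 < (n k)%:R * x k + (m k)%:R * y k by rewrite addr_gt0// mulr_gt0//; lra.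
  have : a k ^+ 2 * (n k)%:R * (m k)%:R / (2 * ((n k)%:R * x k + (m k)%:R * y k)) <= 1 - delta.
    rewrite /delta subKr.
    by apply: (@le_trans _ _ c); [near: k|rewrite le_max lexx orbT].
  rewrite ler_pdivrMr ?mulr_gt0//; lra.
pose K := 2 * (K1 + 1).
have K0 : 0 < K by rewrite mulr_gt0// addr_gt0.
(* As n x and m y are comparable, a^2 n m <= 2 (n x + m y) is at most K m y and at most K n x;
   dividing by m or n bounds a^2 n and a^2 m. *)
have bK : \forall k \near \oo,
    [/\ a k ^+ 2 * (n k)%:R <= K * y k, a k ^+ 2 * (m k)%:R <= K * x k,
     (m k)%:R * y k <= K * ((n k)%:R * x k) & (n k)%:R * x k <= K * ((m k)%:R * y k)].
  near=> k.
  have [h1 h2] : (n k)%:R * x k <= K1 * ((m k)%:R * y k) /\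
    (m k)%:R * y k <= K1 * ((n k)%:R * x k) by near: k.
  have xk : 1 <= x k by near: k.
  have yk : 1 <= y k by near: k.
  have nx : 0 < (n k)%:R * x k by rewrite mulr_gt0//; lra.
  have my : 0 < (m k)%:R * y k by rewrite mulr_gt0//; lra.
  have h3 : a k ^+ 2 * (n k)%:R * (m k)%:R <= 2 * ((n k)%:R * x k + (m k)%:R * y k).
    have : a k ^+ 2 * (n k)%:R * (m k)%:R / 2 <=
      (1 - delta) * ((n k)%:R * x k + (m k)%:R * y k) by near: k.
    have : (1 - delta) * ((n k)%:R * x k + (m k)%:R * y k) <=
      1 * ((n k)%:R * x k + (m k)%:R * y k) by rewrite ler_wpM2r//; lra.
    lra.
  split.
  - by rewrite -(ler_pM2r (m0 k)); apply: le_trans h3 _; rewrite /K; lra.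
  - by rewrite -(ler_pM2r (n0 k)) mulrAC; apply: le_trans h3 _; rewrite /K; lra.
  - by rewrite /K; nra.
  - by rewrite /K; nra.
(* Then eta + 1 - delta + eps = 1 - delta / 2 + delta^2 / 16 <= 1. *)
pose eps := delta / 2; pose eta := eps ^+ 2 / 4.
have eps0 : 0 < eps by rewrite divr_gt0.
have eta0 : 0 < eta by rewrite divr_gt0// exprn_gt0.
have ed : eta + (1 - delta + eps) <= 1 by rewrite /eta /eps; nra.
apply: cvg_minimax => e e0.
(* With lambda <= e1, the product of the two [tau] at most e1^2, and h = e, the loss is at most e /
   2 + 5 e1 / (2 e) <= e. *)
pose e1 := Num.min 1 (e ^+ 2 / 5).
have e10 : 0 < e1 by rewrite lt_min ltr01 divr_gt0// exprn_gt0.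
(* This level gives 3 n p a^2 <= 3 K y exp(- x) <= 1, as the linearisation of the exponential
   requires, and likewise for columns. *)
have K3 : 0 < (3 * K)^-1 by rewrite invr_gt0 mulr_gt0.
have sp := poly_expR_small ltr01 K3 xoo yoo qp_log.
have sq := poly_expR_small ltr01 K3 yoo xoo pq_log.
have tx : \forall k \near \oo, expR ((n k)%:R * expR (- (eta * x k / 2)) -
    eta * x k / a k ^+ 2 / 2) <= e1.
  apply: (@tau_small _ n m x y (fun k => a k ^+ 2) K) => //.
  by apply: filterS bK => k [? _ ? _]; rewrite exprn_gt0.
have ty : \forall k \near \oo, expR ((m k)%:R * expR (- (eta * y k / 2)) -
    eta * y k / a k ^+ 2 / 2) <= e1.
  apply: (@tau_small _ m n y x (fun k => a k ^+ 2) K) => //.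
  by apply: filterS bK => k [_ ? _ ?]; rewrite exprn_gt0.
have l0 : 0 < ln (1 + e1) / 9 by rewrite divr_gt0// ln_gt0// ltrDl.
have small := (cvgrPdist_le _ _).1 a_small _ l0.
near=> k => psi alpha beta tpsi t1 t2.
have xk : 1 <= x k by near: k.
have yk : 1 <= y k by near: k.
have [an am _ _] : [/\ a k ^+ 2 * (n k)%:R <= K * y k, a k ^+ 2 * (m k)%:R <= K * x k,
     (m k)%:R * y k <= K * ((n k)%:R * x k) & (n k)%:R * x k <= K * ((m k)%:R * y k)].
  by near: k.
have spk : y k * expR (- (1 * x k)) <= (3 * K)^-1 by near: k.
have sqk : x k * expR (- (1 * y k)) <= (3 * K)^-1 by near: k.
have txk : expR ((n k)%:R * expR (- (eta * x k / 2)) - eta * x k / a k ^+ 2 / 2) <= e1.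
  by near: k.
have tyk : expR ((m k)%:R * expR (- (eta * y k / 2)) - eta * y k / a k ^+ 2 / 2) <= e1.
  by near: k.
have smallk : `|0 - a k ^+ 2 * (n k)%:R * (m k)%:R * p k * q k| <= ln (1 + e1) / 9.
  near: k; exact: small.
have akmk : a k ^+ 2 * (n k)%:R * (m k)%:R / 2 <=
    (1 - delta) * ((n k)%:R * x k + (m k)%:R * y k) by near: k.
have side (i j : nat) (z w : R) : a k ^+ 2 * i%:R <= K * w -> i%:R / j%:R = expR (- z) ->
    w * expR (- (1 * z)) <= (3 * K)^-1 -> 3 * (i%:R * (i%:R / j%:R) * a k ^+ 2) <= 1.
  move=> h1 -> h2; move: h2; rewrite mul1r => /(ler_wpM2l (ltW K0)) h2.
  have := ler_wpM2r (expR_ge0 (- z)) h1; rewrite -mulrA => h3.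
  have : K * (3 * K)^-1 = 3^-1 by rewrite invfM mulrCA divff ?gt_eqF// mulr1.
  move: h2 h3; set E := expR _; lra.
(* The bound for the full rectangle, scaled by i j / (n m), gives (1 - delta) (i j x / m + i j y /
   n); then j <= m and i <= n conclude. *)
have rec i j : (i <= n k)%N -> (j <= m k)%N ->
    a k ^+ 2 * i%:R * j%:R / 2 <= (1 - delta) * (i%:R * x k + j%:R * y k).
  move=> ik jm; have {}ik : i%:R <= (n k)%:R :> R by rewrite ler_nat.
  have {}jm : j%:R <= (m k)%:R :> R by rewrite ler_nat.
  rewrite -(ler_pM2r (mulr_gt0 (n0 k) (m0 k))).
  have ij : 0 <= i%:R * j%:R :> R by rewrite mulr_ge0.
  have h1 := ler_wpM2r ij akmk.
  have h2 : (1 - delta) * (i%:R * (n k)%:R * x k) * j%:R <=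
            (1 - delta) * (i%:R * (n k)%:R * x k) * (m k)%:R.
    by rewrite ler_wpM2l// mulr_ge0 ?subr_ge0// mulr_ge0 ?mulr_ge0//; lra.
  have h3 : (1 - delta) * (j%:R * (m k)%:R * y k) * i%:R <=
            (1 - delta) * (j%:R * (m k)%:R * y k) * (n k)%:R.
    by rewrite ler_wpM2l// mulr_ge0 ?subr_ge0// mulr_ge0 ?mulr_ge0//; lra.
  lra.
have pk : (n k)%:R / (N k)%:R = expR (- x k) by rewrite -pE px.
have qk : (m k)%:R / (M k)%:R = expR (- y k) by rewrite -qE qy.
have x0 : 0 <= x k by lra.
have y0 : 0 <= y k by lra.
have d01 : 0 <= 1 - delta <= 1 by rewrite subr_ge0 delta1 gerBl ltW.
have := errors_ge (n_range k) (m_range k) (a_gt0 k) x0 y0 eps0 d01 rec pk qk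
  (side _ _ _ _ an pk spk) (side _ _ _ _ am qk sqk) (ltW eta0) ed tpsi e0 erefl t1 t2.
apply: le_trans.
set lam := expR (9 * _) - 1; set t := _ * expR _.
have lame : lam <= e1.
  rewrite lerBlDr addrC -[leRHS]lnK ?posrE ?ler_expR ?addr_gt0// -pE -qE.
  move: smallk; rewrite sub0r normrN ger0_norm; last first.
    by rewrite !mulr_ge0 ?exprn_ge0// ltW.
  lra.
have te : t <= e1 * e1 by rewrite ler_pM ?expR_ge0.
have e11 : e1 <= 1 by rewrite ge_min lexx.
have e15 : e1 <= e ^+ 2 / 5 by rewrite ge_min lexx orbT.
have : (2 * lam + 3 * t) / (2 * e) <= e / 2.
  rewrite ler_pdivrMr ?mulr_gt0//.
  have : e1 * e1 <= e1 by rewrite ler_piMl// ltW.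
  lra.
lra.
Unshelve. all: by end_near. Qed.
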